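(* Let $\zeta$ be the Riemann zeta function. (1) For any $t\in\mathbb R$ and $s>0$, the restriction of $\zeta$ to the set $\{z\in\mathbb C:\operatorname{Re}z>t,\ |\operatorname{Im}z|<s\}\setminus\{1\}$ is definable in $\mathbb R_{\mathrm{an}^*,\exp}$. (2) For any set $\Omega\subseteq\{w\in\mathbb C:\operatorname{Re}w>2\}$ such that $\{\operatorname{Im}w:w\in\Omega\}$ is unbounded, the restriction of $\zeta$ to $\Omega$ is not definable in any o-minimal expansion of $\mathbb R_{\mathrm{an}^*,\exp}$.
   Context: $\mathbb R_{\mathrm{an}^*}$ is the expansion of the ordered real field by all functions $f:\mathbb R^{m+n}\to\mathbb R$ which on $[0,1]^m\times[-1,1]^n$ agree with the sum of a convergent mixed generalized power series $\sum a_{\alpha,\beta}x^\alpha y^\beta$ (real coefficients, $\alpha\in[0,\infty)^m$ ranging in a product of well-ordered subsets of $[0,\infty)$, $\beta\in\mathbb N^n$) satisfying $\sum|a_{\alpha,\beta}|t^\alpha u^\beta<\infty$ for some polyradius $(t,u)$ with all coordinates $>1$, and are $0$ elsewhere. $\mathbb R_{\mathrm{an}^*,\exp}$ is the expansion of $\mathbb R_{\mathrm{an}^*}$ by the real exponential function. A function $\varphi:\Omega\to\mathbb C$ with $\Omega\subseteq\mathbb C$ is definable in an expansion $\mathcal R$ of the real field if the functions $(x,y)\mapsto\operatorname{Re}\varphi(x+iy)$ and $(x,y)\mapsto\operatorname{Im}\varphi(x+iy)$ on $\{(x,y)\in\mathbb R^2:x+iy\in\Omega\}$ are definable in $\mathcal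 R$. *)

(* Defs.v *)
From HB Require Import structures.
From mathcomp Require Import all_boot all_order all_algebra.
From mathcomp Require Import complex.
From mathcomp Require Import all_classical all_reals all_analysis.
From mathcomp Require wochoice.

Set Implicit Arguments.
Unset Strict Implicit.
Unset Printing Implicit Defensive.

Import Order.TTheory GRing.Theory Num.Theory.
Import numFieldNormedType.Exports.

Local Open Scope classical_set_scope.
Local Open Scope complex_scope.
Local Open Scope ring_scope.

(* A first-order structure with universe R is given by its primitive functions
   and relations of each arity. Every primitive serves as its own symbol, so
   that expanding a structure amounts to enlarging the sets of primitives. *)
Record structure (R : realType) := Structure {
  prim_fun : forall n, set ('rV[R]_n -> R);
  prim_rel : forall n, set (set 'rV[R]_n)
}.

Definition expansion_of (R : realType) (M N : structure R) : Prop :=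
  (forall n, prim_fun M (n:=n) `<=` prim_fun N (n:=n)) /\
  (forall n, prim_rel M (n:=n) `<=` prim_rel N (n:=n)).

Section definability.
Variables (R : realType) (M : structure R).

(* TPar: definability is with parameters from R. *)
Inductive term : Type :=
| TVar of nat
| TPar of R
| TApp n (f : 'rV[R]_n -> R) of prim_fun M f & ('I_n -> term).

Inductive formula : Type :=
| FEq of term & term
| FRel n (P : set 'rV[R]_n) of prim_rel M P & ('I_n -> term)
| FNot of formula
| FAnd of formula & formula
| FExists of nat & formula.

Fixpoint teval (e : nat -> R) (t : term) : R :=
  match t with
  | TVar i => e i
  | TPar c => c
  | TApp _ f _ ts => f (\row_j teval e (ts j))
  end.

Fixpoint holds (e : nat -> R) (phi : formula) : Prop :=
  match phi with
  | FEq t u => teval e t = teval e u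
  | FRel _ P _ ts => P (\row_j teval e (ts j))
  | FNot phi => ~ holds e phi
  | FAnd phi psi => holds e phi /\ holds e psi
  | FExists i phi => exists v : R, holds (fun j => if j == i then v else e j) phi
  end.

(* Variables of index >= n are sent to 0; this is harmless, since parameters
   are allowed. *)
Definition env_of n (x : 'rV[R]_n) (i : nat) : R :=
  if insub i is Some j then x 0 j else 0.

Definition definable n (A : set 'rV[R]_n) : Prop :=
  exists phi : formula, forall x, A x <-> holds (env_of x) phi.

Definition definable_fun n (A : set 'rV[R]_n) (g : 'rV[R]_n -> R) : Prop :=
  definable [set row_mx x (const_mx (g x) : 'rV[R]_1) | x in A].

Definition definable_complex (Omega : set R[i]) (phi : R[i] -> R[i]) : Prop :=
  let D := [set v : 'rV[R]_2 | Omega (v 0 0 +i* v 0 1)] in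
  definable_fun D (fun v => complex.Re (phi (v 0 0 +i* v 0 1))) /\
  definable_fun D (fun v => complex.Im (phi (v 0 0 +i* v 0 1))).

(* [interval R] comprises bounded and unbounded intervals as well as points. *)
Definition o_minimal : Prop :=
  forall A : set R, definable [set x : 'rV[R]_1 | A (x 0 0)] ->
    exists s : seq (interval R), A = [set x | exists2 I, I \in s & x \in I].

End definability.

Section real_structures.
Variable R : realType.

Inductive field_fun : forall n, ('rV[R]_n -> R) -> Prop :=
| FieldZero : @field_fun 0 (fun=> 0)
| FieldOne : @field_fun 0 (fun=> 1)
| FieldOpp : @field_fun 1 (fun x => - x 0 0)
| FieldAdd : @field_fun 2 (fun x => x 0 0 + x 0 1)
| FieldMul : @field_fun 2 (fun x => x 0 0 * x 0 1).

Inductive order_rel : forall n, set 'rV[R]_n -> Prop :=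
| OrderLt : @order_rel 2 [set x | x 0 0 < x 0 1].

(* The unordered sum of a family, meaningful when the family is summable. *)
Definition family_sum (T : choiceType) (f : T -> R) : R :=
  fine (\esum_(i in [set: T]) (Num.max (f i) 0)%:E
        - \esum_(i in [set: T]) (Num.max (- f i) 0)%:E)%E.

(* The monomial x^alpha y^beta; note that 0 `^ 0 = 1 and 0 `^ a = 0 for
   a != 0. *)
Definition mixed_monomial m n (x : 'rV[R]_m) (y : 'rV[R]_n)
    (p : 'rV[R]_m * 'rV[nat]_n) : R :=
  (\prod_i x 0 i `^ p.1 0 i) * (\prod_j y 0 j ^+ p.2 0 j).

(* A mixed generalized power series is given by its coefficient family, indexed
   by all pairs (alpha, beta) and vanishing off a product of well-ordered
   subsets of [0, +oo[ times nat^n. *)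
Definition mixed_series m n (a : 'rV[R]_m * 'rV[nat]_n -> R) : Prop :=
  exists S : 'I_m -> set R,
    (forall i, S i `<=` [set c | 0 <= c] /\
               wochoice.wo_chain <=%R (mem (S i))) /\
    (forall p, a p != 0 -> forall i, S i (p.1 0 i)).

Definition converges_at m n (a : 'rV[R]_m * 'rV[nat]_n -> R)
    (t : 'rV[R]_m) (u : 'rV[R]_n) : Prop :=
  summable [set: 'rV[R]_m * 'rV[nat]_n]
    (fun p => (`|a p| * mixed_monomial t u p)%:E).

Definition an_star m n (f : 'rV[R]_(m + n) -> R) : Prop :=
  exists a : 'rV[R]_m * 'rV[nat]_n -> R,
    [/\ mixed_series a,
        exists (t : 'rV[R]_m) (u : 'rV[R]_n),
          [/\ forall i, 1 < t 0 i, forall j, 1 < u 0 j & converges_at a t u] &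
        forall (x : 'rV[R]_m) (y : 'rV[R]_n),
          f (row_mx x y) =
            if [forall i, 0 <= x 0 i <= 1] && [forall j, -1 <= y 0 j <= 1]
            then family_sum (fun p => a p * mixed_monomial x y p)
            else 0].

Inductive an_star_fun : forall k, ('rV[R]_k -> R) -> Prop :=
| AnStar m n (f : 'rV[R]_(m + n) -> R) of an_star f : an_star_fun f.

Inductive exp_fun : forall n, ('rV[R]_n -> R) -> Prop :=
| ExpFun : @exp_fun 1 (fun x => expR (x 0 0)).

Definition R_an_star : structure R :=
  Structure (fun n f => field_fun f \/ an_star_fun f) order_rel.

Definition R_an_star_exp : structure R :=
  Structure (fun n f => prim_fun R_an_star f \/ exp_fun f)
            (fun n => prim_rel R_an_star (n:=n)).

End real_structures.

Section riemann_zeta.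
Variable R : realType.

Definition expC (z : R[i]) : R[i] :=
  (expR (complex.Re z) * cos (complex.Im z)) +i* (expR (complex.Re z) * sin (complex.Im z)).

Definition analytic_at (f : R[i] -> R[i]) (z : R[i]) : Prop :=
  exists (r : R) (c : nat -> R[i]), 0 < r /\
    forall w, `|w - z| < r%:C ->
      [series c k * (w - z) ^+ k]_k @ \oo --> (f w : R[i]^o).

(* zeta is the analytic continuation to C \ {1} of the sum over n >= 1 of
   n^(-s) = exp (- s ln n), Re s > 1; the value at 1 is irrelevant. *)
Definition is_riemann_zeta (zeta : R[i] -> R[i]) : Prop :=
  (forall s, s != 1 -> analytic_at zeta s) /\
  (forall s, 1 < complex.Re s ->
    [series expC (- s * (ln n.+1%:R)%:C)]_n @ \oo --> (zeta s : R[i]^o)).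

End riemann_zeta.

(* Main.v *)
(* Part 1.  For [Re z >= T] with [T] large compared to [s], putting
   [X = exp (T - Re z)] and [Y = Im z / s] turns [n ^ (- z)] into a constant times
   [X ^ (ln n) * exp (- 'i * (ln n) * s * Y)]; expanding the exponential in powers
   of [Y] makes the Dirichlet series a mixed generalized power series in [(X, Y)].
   The remaining rectangle is compact, and there [zeta z = h z / (z - 1)] with [h]
   entire, hence given locally by restricted analytic functions.  That [h] is
   analytic at 1 follows from
     [w * zeta (1 + w) = 1 + \sum_n (w / n - 1 + (1 + 1 / n) ^ (- w)) * n ^ (- w)],
   whose terms have power series in [w] that are jointly absolutely summable
   near 0; the identity theorem transports the formula across [Re w = 0].

   Part 2.  Consider the [tau] such that, for some [x + 'i * tau] in [Omega],
   [Re (zeta (x + 'i * tau)) < zeta x - 2 ^ (- x)].  This set is definable, as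
   [zeta] is definable on [x > 2] by part 1, so by o-minimality it eventually
   contains all or none of the [tau] occurring in [Omega].  But the inequality
   holds, for all [x > 2], whenever [cos (tau * ln 2) < 0], and fails, for all
   [x > 2], whenever [tau * ln n] is close to [2 * pi * Z] for [n <= 16]; both
   kinds of [tau] are arbitrarily large, by Dirichlet's pigeonhole argument. *)

Require Import Defs.
From HB Require Import structures.
From mathcomp Require Import all_boot all_order all_algebra.
From mathcomp Require Import complex.
From mathcomp Require Import all_classical all_reals all_analysis.
From mathcomp Require Import ring lra zify.
From mathcomp Require wochoice.

Import Order.TTheory GRing.Theory Num.Theory.
Import numFieldNormedType.Exports.

Local Open Scope classical_set_scope.
Local Open Scope complex_scope.
Local Open Scope ring_scope.

Set Implicit Arguments.
Unset Strict Implicit.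
Unset Printing Implicit Defensive.

(** * Absolutely summable families *)

(** The obstacle in part 1 is that a primitive sees only a compact box, whereas the half-strip is
    unbounded. The substitution [X = exp (T - Re z)] brings the end at infinity to [X = 0], and
    generalized exponents are forced because [n ^ (- z)] then involves the real power [ln n] of [X].
    The choice [T = 3 + 2 * s] pays for convergence at the polyradius [(2, 2)]: this costs a factor
    [n ^ (ln 2 + 2 * s)], where [ln 2 <= 1], so that [n ^ (- T)] still leaves [n ^ (- 2)].

    The obstacle in part 2 is that nothing is known about the [x] that goes with a given [tau]; it
    may grow with [tau]. The test must therefore be decided by [tau] alone. Comparison with [zeta x]
    at the same [x] leaves the nonnegative terms [n ^ (- x) * (1 - cos (tau * ln n))], and
    [2 ^ (- x)] is the scale of the leading one, so that both outcomes hold uniformly in [x].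
    Recurrence times need not occur as heights of points of [Omega]; this is why o-minimality is
    also applied to the set of these heights, separately in the directions [+oo] and [-oo]. *)

Section summation.
Variable R : realType.

Lemma ge0_series_cvg (g : nat -> R) : (forall n, 0 <= g n) ->
  (\esum_(n in [set: nat]) (g n)%:E < +oo)%E ->
  series g @ \oo --> fine (\esum_(n in [set: nat]) (g n)%:E).
Proof.
move=> g0 gfin.
have sg : summable xpredT (EFin \o g).
  rewrite /summable (_ : xpredT = [set: nat] :> set nat); last first.
    by apply/seteqP; split.
  by rewrite (eq_esum (b := fun n => (g n)%:E))// => n _ /=; rewrite ger0_norm.
have /= cg := summable_cvg (fun n _ => g0 n : (0%E <= (EFin \o g) n)%E) sg.
have := summable_nneseries_lim (fun n _ => g0 n : (0%E <= (EFin \o g) n)%E) sg.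
rewrite nneseries_esumT => [->|n]; last by rewrite lee_fin.
exact: cg.
Qed.

Lemma ge0_esum_prod (I J : choiceType) (g : I * J -> R) : (forall p, 0 <= g p) ->
  \esum_(i in [set: I]) \esum_(j in [set: J]) (g (i, j))%:E =
  \esum_(p in [set: I * J]) (g p)%:E.
Proof.
move=> g0; rewrite esum_esum => [|i j _ _]; last by rewrite lee_fin.
have -> : [set: I] `*`` (fun=> [set: J]) = [set: I * J] by apply/seteqP; split.
by apply: eq_esum => -[].
Qed.

Lemma ge0_fubini (g : nat * nat -> R) : (forall p, 0 <= g p) ->
  (\esum_(p in [set: nat * nat]) (g p)%:E < +oo)%E ->
  exists r : nat -> R,
    (forall i, series (fun j => g (i, j)) @ \oo --> r i) /\
    series r @ \oo --> fine (\esum_(p in [set: nat * nat]) (g p)%:E).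
Proof.
move=> g0 gfin.
pose E i := \esum_(j in [set: nat]) (g (i, j))%:E.
have E0 i : (0 <= E i)%E by apply: esum_ge0 => j _; rewrite lee_fin.
have sE : (\esum_(i in [set: nat]) E i < +oo)%E by rewrite ge0_esum_prod.
have Efin i : (E i < +oo)%E.
  rewrite -[E i]gee0_abs//; apply: (summable_pinfty (D := [set: nat])) => //.
  by rewrite /summable (eq_esum (b := E))// => n _; rewrite gee0_abs.
have EE i : (fine (E i))%:E = E i by rewrite fineK// ge0_fin_numE.
exists (fun i => fine (E i)); split => [i|].
  by apply: ge0_series_cvg (Efin i) => j; exact: g0.
have eqE : \esum_(p in [set: nat * nat]) (g p)%:E =
    \esum_(i in [set: nat]) (fine (E i))%:E.
  by rewrite -ge0_esum_prod//; apply: eq_esum => i _; rewrite EE.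
rewrite eqE; apply: ge0_series_cvg => [i|]; first exact: fine_ge0.
by rewrite -eqE.
Qed.

Definition abs_summable (T : choiceType) (f : T -> R) :=
  (\esum_(i in [set: T]) (`|f i|)%:E < +oo)%E.

Lemma le_abs_summable (T : choiceType) (f g : T -> R) :
  (forall i, `|f i| <= `|g i|) -> abs_summable g -> abs_summable f.
Proof. by move=> fg; apply: le_lt_trans; apply: le_esum => i _; rewrite lee_fin. Qed.

Lemma abs_summable_max (T : choiceType) (f : T -> R) : abs_summable f ->
  abs_summable (fun i => Num.max (f i) 0).
Proof.
apply: le_abs_summable => i.
by have [fi|fi] := leP (f i) 0; rewrite ?normr0.
Qed.

Lemma abs_summableN (T : choiceType) (f : T -> R) : abs_summable f ->
  abs_summable (fun i => - f i).
Proof. by apply: le_abs_summable => i; rewrite normrN. Qed.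

Lemma ge0_abs_summable (T : choiceType) (f : T -> R) : (forall i, 0 <= f i) ->
  abs_summable f = (\esum_(i in [set: T]) (f i)%:E < +oo)%E.
Proof.
by move=> f0; congr (_ < _)%E; apply: eq_esum => i _; rewrite ger0_norm.
Qed.

Lemma max0_ge0 (x : R) : 0 <= Num.max x 0. Proof. by rewrite le_max lexx orbT. Qed.

Lemma max0B (x : R) : Num.max x 0 - Num.max (- x) 0 = x.
Proof. by have [] := leP x 0; have [] := leP (- x) 0; lra. Qed.

Lemma family_sumE (T : choiceType) (f : T -> R) : abs_summable f ->
  family_sum f = fine (\esum_(i in [set: T]) (Num.max (f i) 0)%:E) -
                 fine (\esum_(i in [set: T]) (Num.max (- f i) 0)%:E).
Proof.
move=> sf; rewrite /family_sum fineB// ge0_fin_numE ?esum_ge0//.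
- by rewrite -ge0_abs_summable ?abs_summable_max// => i; exact: max0_ge0.
- by move=> i _; rewrite lee_fin max0_ge0.
- rewrite -ge0_abs_summable => [|i]; last exact: max0_ge0.
  exact/abs_summable_max/abs_summableN.
- by move=> i _; rewrite lee_fin max0_ge0.
Qed.

Lemma seriesB_fun (f g : nat -> R) : series (fun n => f n - g n) = series f \- series g.
Proof. by apply/funext => n; rewrite /series/= sumrB. Qed.

(** Positive and negative parts each fall under [ge0_fubini]. This is the bridge between the
    unordered [family_sum] of the primitives and the iterated series in which zeta is given. *)
Lemma fubini_series (f : nat * nat -> R) : abs_summable f ->
  exists r : nat -> R,
    (forall i, series (fun j => f (i, j)) @ \oo --> r i) /\
    series r @ \oo --> family_sum f.
Proof.
move=> sf.
have m0 p : 0 <= Num.max (f p) 0 by exact: max0_ge0.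
have m0' p : 0 <= Num.max (- f p) 0 by exact: max0_ge0.
have [|r1 [r1P s1]] := ge0_fubini m0.
  by rewrite -ge0_abs_summable//; exact: abs_summable_max.
have [|r2 [r2P s2]] := ge0_fubini m0'.
  by rewrite -ge0_abs_summable//; exact/abs_summable_max/abs_summableN.
exists (fun i => r1 i - r2 i); split => [i|]; last first.
  by rewrite seriesB_fun family_sumE//; exact: cvgB.
rewrite [in series _](_ : (fun j => f (i, j)) =
     fun j => Num.max (f (i, j)) 0 - Num.max (- f (i, j)) 0); last first.
    by apply/funext => n; rewrite max0B.
by rewrite seriesB_fun; exact: cvgB.
Qed.

Lemma esum_inj (T I : choiceType) (e : I -> T) (a : T -> \bar R) :
  injective e -> (forall t, ~ range e t -> a t = 0%E) ->
  \esum_(t in [set: T]) a t = \esum_(i in [set: I]) a (e i).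
Proof.
move=> ei a0; rewrite -(@esum_image _ _ _ [set: I] e a); last by move=> x y _ _ /ei.
rewrite [RHS]esum_mkcond; apply: eq_esum => t _.
case: ifPn => // /negP te; apply: a0 => te'; apply: te; exact/mem_set.
Qed.

Lemma abs_summable_inj (T I : choiceType) (e : I -> T) (f : T -> R) :
  injective e -> (forall t, ~ range e t -> f t = 0) ->
  abs_summable f = abs_summable (f \o e).
Proof.
move=> ei f0; congr (_ < _)%E; apply: esum_inj => // t te.
by rewrite f0// normr0.
Qed.

Lemma family_sum_inj (T I : choiceType) (e : I -> T) (f : T -> R) :
  injective e -> (forall t, ~ range e t -> f t = 0) ->
  family_sum f = family_sum (f \o e).
Proof.
move=> ei f0; rewrite /family_sum; congr (fine (_ - _)).
  by apply: esum_inj => // t te; rewrite f0// maxxx.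
by apply: esum_inj => // t te; rewrite f0// oppr0 maxxx.
Qed.

(** Transposition is an injective reindexing, so both iterated sums equal the same unordered sum. *)
Lemma fubini_series2 (f : nat -> nat -> R) : abs_summable (fun p => f p.1 p.2) ->
  exists (r c : nat -> R) (s : R),
    [/\ forall i, series (f i) @ \oo --> r i,
        forall j, series (f^~ j) @ \oo --> c j,
        series r @ \oo --> s & series c @ \oo --> s].
Proof.
move=> sf; pose e (p : nat * nat) := (p.2, p.1).
have ei : injective e by move=> [a b] [c d] [-> ->].
have e0 (g : nat * nat -> R) t : ~ range e t -> g t = 0.
  by case: t => a b []; exists (b, a).
have [r [rP rs]] := fubini_series sf.
have sf' := sf; rewrite (abs_summable_inj ei (e0 _)) in sf'.
have [c [cP cs]] := fubini_series sf'.
exists r, c, (family_sum (fun p => f p.1 p.2)); split => //.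
by rewrite (family_sum_inj ei (e0 _)).
Qed.

Lemma series_bounded_esum (g : nat -> R) (M : R) : (forall n, 0 <= g n) ->
  (forall n, series g n <= M) -> (\esum_(n in [set: nat]) (g n)%:E <= M%:E)%E.
Proof.
move=> g0 gM; rewrite -nneseries_esumT => [|n]; last by rewrite lee_fin.
apply: lime_le.
  by apply: is_cvg_nneseries => n _ _; rewrite lee_fin.
by apply: nearW => n; rewrite sumEFin lee_fin; exact: gM.
Qed.

Lemma abs_summable2 (f : nat -> nat -> R) (b : nat -> R) (M : R) :
  (forall i n, series (fun j => `|f i j|) n <= b i) ->
  (forall n, series b n <= M) -> abs_summable (fun p => f p.1 p.2).
Proof.
move=> fb bM; rewrite /abs_summable -(ge0_esum_prod (g := fun p => `|f p.1 p.2|))//.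
have b0 i : 0 <= b i by apply: le_trans (fb i 0%N); rewrite /series/= big_nil.
apply: (@le_lt_trans _ _ M%:E); last exact: ltry.
apply: (le_trans _ (series_bounded_esum b0 bM)); apply: le_esum => i _ /=.
exact: series_bounded_esum.
Qed.

Lemma series_le_lim (g : nat -> R) (l : R) : (forall n, 0 <= g n) ->
  series g @ \oo --> l -> forall n, series g n <= l.
Proof.
move=> g0 gl n; rewrite -(cvg_lim _ gl)//; apply: nondecreasing_cvgn_le.
  by apply: nondecreasing_series.
exact: cvgP gl.
Qed.

End summation.

(** * Complex series *)

Section complex_sequences.
Variable R : realType.
Implicit Types (z w : R[i]) (x y : R).

(** The norm of [R[i]] has values in [R[i]]; its real part brings estimates into the ordered field
    [R]. *)
Definition nrm z : R := complex.Re `|z|.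

Lemma nrmE z : `|z| = (nrm z)%:C.
Proof. by rewrite /nrm normc_def. Qed.

Lemma nrm_ge0 z : 0 <= nrm z. Proof. by rewrite -lecR -nrmE; exact: normr_ge0. Qed.

Lemma nrm0 : nrm 0 = 0. Proof. by apply: complexI; rewrite -nrmE normr0. Qed.

Lemma nrm1 : nrm 1 = 1. Proof. by apply: complexI; rewrite -nrmE normr1. Qed.

Lemma nrmN z : nrm (- z) = nrm z.
Proof. by apply: complexI; rewrite -!nrmE normrN. Qed.

Lemma nrmB z w : nrm (z - w) = nrm (w - z).
Proof. by rewrite -nrmN opprB. Qed.

Lemma nrmM z w : nrm (z * w) = nrm z * nrm w.
Proof. by apply: complexI; rewrite rmorphM/= -!nrmE normrM. Qed.

Lemma nrmX z n : nrm (z ^+ n) = nrm z ^+ n.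
Proof. by apply: complexI; rewrite rmorphXn/= -!nrmE normrX. Qed.

Lemma nrmR x : nrm x%:C = `|x|.
Proof. by apply: complexI; rewrite -nrmE normc_def/= expr0n addr0 sqrtr_sqr. Qed.

Lemma nrmV z : nrm z^-1 = (nrm z)^-1.
Proof. by apply: complexI; rewrite fmorphV/= -!nrmE normfV. Qed.

Lemma le_nrmD z w : nrm (z + w) <= nrm z + nrm w.
Proof. by rewrite -lecR rmorphD/= -!nrmE ler_normD. Qed.

Lemma nrm_eq0 z : (nrm z == 0) = (z == 0).
Proof. by rewrite -(inj_eq (@complexI R)) -nrmE normr_eq0. Qed.

Lemma nrm_gt0 z : (0 < nrm z) = (z != 0).
Proof. by rewrite lt0r nrm_eq0 nrm_ge0 andbT. Qed.

Lemma nrm_i : nrm 'i = 1.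
Proof. by rewrite /nrm normc_def/= expr0n/= expr1n add0r sqrtr1. Qed.

Lemma normRe_le z : `|complex.Re z| <= nrm z.
Proof. by rewrite -lecR -nrmE normc_ge_Re. Qed.

Lemma normIm_le z : `|complex.Im z| <= nrm z.
Proof.
rewrite -[complex.Im z]opprK -ReiNIm normrN; apply: le_trans (normRe_le _) _.
by rewrite nrmM nrm_i mulr1.
Qed.

Lemma nrm_le z : nrm z <= `|complex.Re z| + `|complex.Im z|.
Proof.
have -> : nrm z = nrm ((complex.Re z)%:C + 'i * (complex.Im z)%:C) by rewrite -complexE.
apply: le_trans (le_nrmD _ _) _; by rewrite nrmM !nrmR nrm_i mul1r.
Qed.

Lemma ReD z w : complex.Re (z + w) = complex.Re z + complex.Re w.
Proof. by case: z; case: w. Qed.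
Lemma ImD z w : complex.Im (z + w) = complex.Im z + complex.Im w.
Proof. by case: z; case: w. Qed.
Lemma ReB z w : complex.Re (z - w) = complex.Re z - complex.Re w.
Proof. by case: z; case: w. Qed.
Lemma ImB z w : complex.Im (z - w) = complex.Im z - complex.Im w.
Proof. by case: z; case: w. Qed.
Lemma ReM z w : complex.Re (z * w) =
  complex.Re z * complex.Re w - complex.Im z * complex.Im w.
Proof. by case: z; case: w. Qed.
Lemma ImM z w : complex.Im (z * w) =
  complex.Re z * complex.Im w + complex.Im z * complex.Re w.
Proof. by case: z => a b; case: w => c d /=; ring. Qed.

Lemma Re_sum (I : Type) (r : seq I) (F : I -> R[i]) :
  complex.Re (\sum_(i <- r) F i) = \sum_(i <- r) complex.Re (F i).
Proof. by elim/big_ind2: _ => // [z a w b <- <-]; rewrite ReD. Qed.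
Lemma Im_sum (I : Type) (r : seq I) (F : I -> R[i]) :
  complex.Im (\sum_(i <- r) F i) = \sum_(i <- r) complex.Im (F i).
Proof. by elim/big_ind2: _ => // [z a w b <- <-]; rewrite ImD. Qed.

Lemma gtc0_real (e : R[i]) : 0 < e -> exists2 x : R, 0 < x & e = x%:C.
Proof.
move=> e0; have /complex_realP[x ex] : e \is Num.real by exact: gtr0_real.
by exists x; rewrite -?ltcR// -ex.
Qed.

Lemma cvg_nrmP (u : nat -> R[i]) (l : R[i]) :
  u @ \oo --> (l : R[i]^o) <->
  (forall e : R, 0 < e -> \forall n \near \oo, nrm (l - u n) < e).
Proof.
have [H1 H2] := @cvgrPdist_lt R[i] R[i]^o nat \oo _ u l.
split=> [/H1 ul e e0|ul].
  have ec0 : 0 < e%:C by rewrite ltcR.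
  by near do rewrite -ltcR -nrmE; exact: ul.
apply: H2 => _ /gtc0_real[e e0 ->].
by near do rewrite nrmE ltcR; exact: ul.
Unshelve. all: by end_near. Qed.

Lemma cvg_complexP (u : nat -> R[i]) (l : R[i]) :
  u @ \oo --> (l : R[i]^o) <->
  ((fun n => complex.Re (u n)) @ \oo --> complex.Re l /\
   (fun n => complex.Im (u n)) @ \oo --> complex.Im l).
Proof.
rewrite cvg_nrmP; split => [ul|[/cvgrPdist_lt ur /cvgrPdist_lt ui] e e0].
  split; apply/cvgrPdist_lt => e e0; near=> n.
    rewrite -ReB (le_lt_trans (normRe_le _))//; near: n; exact: ul.
  rewrite -ImB (le_lt_trans (normIm_le _))//; near: n; exact: ul.
have e20 : 0 < e / 2 by rewrite divr_gt0.
near=> n; rewrite (le_lt_trans (nrm_le _))// ReB ImB [e]splitr ltrD//.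
  by near: n; exact: ur.
by near: n; exact: ui.
Unshelve. all: by end_near. Qed.

Lemma seriesC_P (a : nat -> R[i]) (s : R[i]) :
  series a @ \oo --> (s : R[i]^o) <->
  (series (fun n => complex.Re (a n)) @ \oo --> complex.Re s /\
   series (fun n => complex.Im (a n)) @ \oo --> complex.Im s).
Proof.
rewrite cvg_complexP.
have -> : (fun n => complex.Re (series a n)) = series (fun n => complex.Re (a n)).
  by apply/funext => n; rewrite /series/= Re_sum.
have -> : (fun n => complex.Im (series a n)) = series (fun n => complex.Im (a n)).
  by apply/funext => n; rewrite /series/= Im_sum.
by [].
Qed.

Lemma cvgC_unique (u : nat -> R[i]) (l l' : R[i]) :
  u @ \oo --> (l : R[i]^o) -> u @ \oo --> (l' : R[i]^o) -> l = l'.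
Proof.
move=> /cvg_complexP[ur ui] /cvg_complexP[ur' ui'].
apply/eqP; rewrite eq_complex; apply/andP; split; apply/eqP.
  by rewrite -(cvg_lim (@Rhausdorff R) ur) -(cvg_lim (@Rhausdorff R) ur').
by rewrite -(cvg_lim (@Rhausdorff R) ui) -(cvg_lim (@Rhausdorff R) ui').
Qed.

Lemma abs_summable_Re_Im (T : choiceType) (F : T -> R[i]) :
  abs_summable (fun t => nrm (F t)) ->
  abs_summable (fun t => complex.Re (F t)) /\ abs_summable (fun t => complex.Im (F t)).
Proof.
move=> sF; split; apply: le_abs_summable sF => t; rewrite [leRHS]ger0_norm ?nrm_ge0//.
  exact: normRe_le.
exact: normIm_le.
Qed.

Lemma fubiniC (F : nat -> nat -> R[i]) :
  abs_summable (fun p : nat * nat => nrm (F p.1 p.2)) ->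
  exists (r c : nat -> R[i]) (s : R[i]),
    [/\ forall i, series (F i) @ \oo --> (r i : R[i]^o),
        forall j, series (F^~ j) @ \oo --> (c j : R[i]^o),
        series r @ \oo --> (s : R[i]^o) & series c @ \oo --> (s : R[i]^o)].
Proof.
move=> /abs_summable_Re_Im[].
move=> /(@fubini_series2 _ (fun i j => complex.Re (F i j)))[r [c [s [rP cP rs cs]]]].
move=> /(@fubini_series2 _ (fun i j => complex.Im (F i j)))[r' [c' [s' [rP' cP' rs' cs']]]].
exists (fun i => r i +i* r' i), (fun i => c i +i* c' i), (s +i* s').
by split => [i|i||]; apply/seriesC_P.
Qed.

Lemma seriesCZ (a : R[i]) (F : nat -> R[i]) (s : R[i]) :
  series F @ \oo --> (s : R[i]^o) ->
  series (fun n => a * F n) @ \oo --> ((a * s : R[i]) : R[i]^o).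
Proof.
move=> /cvg_complexP[Fr Fi].
rewrite (_ : series _ = (fun n => a * series F n)); last first.
  by apply/funext => n; rewrite /series/= mulr_sumr.
apply/cvg_complexP; split.
  rewrite ReM; under eq_fun do rewrite ReM.
  by apply: cvgB; apply: cvgM => //; exact: cvg_cst.
rewrite ImM; under eq_fun do rewrite ImM.
by apply: cvgD; apply: cvgM => //; exact: cvg_cst.
Qed.

Lemma seriesCD (F G : nat -> R[i]) (s t : R[i]) :
  series F @ \oo --> (s : R[i]^o) -> series G @ \oo --> (t : R[i]^o) ->
  series (fun n => F n + G n) @ \oo --> ((s + t : R[i]) : R[i]^o).
Proof.
move=> /cvg_complexP[Fr Fi] /cvg_complexP[Gr Gi].
rewrite (_ : series _ = (fun n => series F n + series G n)); last first.
  by apply/funext => n; rewrite /series/= big_split.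
apply/cvg_complexP; split.
  by rewrite ReD; under eq_fun do rewrite ReD; exact: cvgD.
by rewrite ImD; under eq_fun do rewrite ImD; exact: cvgD.
Qed.

Lemma seriesC_fin (F : nat -> R[i]) N : (forall n, (N <= n)%N -> F n = 0) ->
  series F @ \oo --> ((\sum_(i < N) F i : R[i]) : R[i]^o).
Proof.
move=> F0; apply/cvg_nrmP => e e0; near=> n.
rewrite /series/= (big_cat_nat (n := N))//=; last by near: n; exact: nbhs_infty_ge.
rewrite [X in _ - (_ + X)]big1_seq ?addr0 => [|i]; last first.
  by rewrite mem_index_iota => /andP[_ /andP[Ni _]]; exact: F0.
by rewrite big_mkord subrr nrm0.
Unshelve. all: by end_near. Qed.

Lemma seriesC_terms_bounded (F : nat -> R[i]) (s : R[i]) :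
  series F @ \oo --> (s : R[i]^o) -> exists K : R, forall n, nrm (F n) <= K.
Proof.
move=> /seriesC_P[/cvgP sr /cvgP si].
have [Kr Krp] := cvg_seq_bounded (cvgP _ (cvg_series_cvg_0 sr)).
have [Ki Kip] := cvg_seq_bounded (cvgP _ (cvg_series_cvg_0 si)).
exists (`|Kr| + 1 + (`|Ki| + 1)) => n; apply: le_trans (nrm_le _) _.
apply: lerD.
  apply: (Krp.2 (`|Kr| + 1)) => //=; first by rewrite ltr_pwDr// ler_norm.
apply: (Kip.2 (`|Ki| + 1)) => //=; by rewrite ltr_pwDr// ler_norm.
Qed.

End complex_sequences.
Arguments seriesCZ {R} a {F s} _.

(** * Analytic functions and the identity theorem *)

Section analytic_functions.
Variable R : realType.
Implicit Types (z w v a b : R[i]) (c d : nat -> R[i]) (f g : R[i] -> R[i]).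

Lemma analytic_atP f z : analytic_at f z <->
  exists (r : R) c, 0 < r /\ forall w, nrm (w - z) < r ->
    series (fun k => c k * (w - z) ^+ k) @ \oo --> (f w : R[i]^o).
Proof.
by split=> -[r [c [r0 cf]]]; exists r, c; split => // w wz; apply: cf;
  move: wz; rewrite nrmE ltcR.
Qed.

(** By uniqueness of limits the row and column sums may be prescribed; this form serves to rearrange
    a given double series. *)
Lemma fubiniC_swap (F : nat -> nat -> R[i]) (r c : nat -> R[i]) (s : R[i]) :
  abs_summable (fun p : nat * nat => nrm (F p.1 p.2)) ->
  (forall i, series (F i) @ \oo --> (r i : R[i]^o)) ->
  (forall j, series (F^~ j) @ \oo --> (c j : R[i]^o)) ->
  series r @ \oo --> (s : R[i]^o) -> series c @ \oo --> (s : R[i]^o).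
Proof.
move=> /fubiniC[r' [c' [s' [r'P c'P r's c's]]]] rP cP rs.
have er : r = r' by apply/funext => i; exact: cvgC_unique (rP i) (r'P i).
have -> : c = c' by apply/funext => i; exact: cvgC_unique (cP i) (c'P i).
by rewrite er in rs; rewrite (cvgC_unique rs r's).
Qed.

Lemma geometric_series_le (q : R) n : 0 <= q < 1 ->
  series (fun k => q ^+ k) n <= (1 - q)^-1.
Proof.
move=> /andP[q0 q1]; rewrite -[leRHS]mul1r ler_pdivlMr ?subr_gt0// mulrC.
have -> : (1 - q) * series (fun k => q ^+ k) n = 1 - q ^+ n.
  rewrite /series/=; elim: n => [|n ih]; first by rewrite big_nil expr0 subrr mulr0.
  by rewrite big_nat_recr//= mulrDr ih exprS; ring.
by rewrite lerBlDr lerDl exprn_ge0.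
Qed.

Lemma finite_series_le (g : nat -> R) (N n : nat) : (forall j, 0 <= g j) ->
  (forall j, (N <= j)%N -> g j = 0) -> series g n <= \sum_(i < N) g i.
Proof.
move=> g0 gN; rewrite -(big_mkord xpredT).
have ND : {homo series g : m k / (m <= k)%N >-> m <= k}.
  by apply: nondecreasing_series => k _ _; exact: g0.
apply: (@le_trans _ _ (series g (N + n))).
  by apply: ND; rewrite leq_addl.
rewrite /series/= (big_cat_nat (n := N))//= ?leq_addr// [X in _ + X]big1_seq ?addr0// => i.
by rewrite mem_index_iota => /andP[_ /andP[Ni _]]; exact: gN.
Qed.

(** Abel's lemma: the terms are bounded at some [t] strictly between [rho] and [r], so at [rho] they
    are dominated by a geometric series of ratio [rho / t]. *)
Lemma power_series_abs_bounded c (r rho : R) :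
  (forall w, nrm w < r -> exists s : R[i],
    series (fun k => c k * w ^+ k) @ \oo --> (s : R[i]^o)) ->
  0 <= rho < r -> exists M, forall n, series (fun k => nrm (c k) * rho ^+ k) n <= M.
Proof.
move=> cr /andP[rho0 rhor].
pose t := (rho + r) / 2.
have rt : rho < t by rewrite /t; lra.
have t0 : 0 < t by lra.
have [|s cs] := cr t%:C; first by rewrite nrmR gtr0_norm /t//; lra.
have [K KP] := seriesC_terms_bounded cs.
have K0 : 0 <= K by apply: le_trans (KP 0%N); exact: nrm_ge0.
exists (K * (1 - rho / t)^-1) => n.
apply: (@le_trans _ _ (K * series (fun k => (rho / t) ^+ k) n)); last first.
  rewrite ler_wpM2l// geometric_series_le// divr_ge0 ?(ltW t0)//=.
  by rewrite ltr_pdivrMr// mul1r.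
rewrite /series/= mulr_sumr; apply: ler_sum => k _.
have := KP k; rewrite nrmM nrmX nrmR (gtr0_norm t0) => KPk.
rewrite expr_div_n mulrA ler_pdivlMr ?exprn_gt0// mulrAC.
by rewrite ler_wpM2r ?exprn_ge0.
Qed.

(* Were [c k] the first nonzero coefficient, the remaining terms would be
   negligible against [c k * v ^+ k] for small [v]. *)
Lemma power_series_zeros c (F : R[i] -> R[i]) (r : R) : 0 < r ->
  (forall v, nrm v < r -> series (fun k => c k * v ^+ k) @ \oo --> (F v : R[i]^o)) ->
  (forall e : R, 0 < e -> exists v, [/\ v != 0, nrm v < e & F v = 0]) ->
  forall k, c k = 0.
Proof.
move=> r0 cF zF.
pose rho := r / 2.
have rho0 : 0 < rho by rewrite /rho; lra.
have [||M MP] := @power_series_abs_bounded c r rho.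
- by move=> w wr; exists (F w); exact: cF.
- by rewrite /rho; lra.
have M0 : 0 <= M by have := MP 0%N; rewrite /series/= big_nil.
move=> k; elim/ltn_ind: k => k ihk.
apply/eqP/negPn/negP; rewrite -nrm_gt0 => ck0.
(* The second bound gives [nrm v * M < nrm (c k) * rho ^+ k.+1], which is exactly the positivity of
   [del] below; [M + 1] keeps the divisor positive when [M = 0]. *)
have [|v [v0 vlt Fv]] := zF (Num.min rho (nrm (c k) * rho ^+ k.+1 / (M + 1))).
  by rewrite lt_min rho0/= divr_gt0 ?mulr_gt0 ?exprn_gt0//; lra.
move: vlt; rewrite lt_min => /andP[vrho]; rewrite ltr_pdivlMr; last lra.
move=> vck.
have nv0 : 0 < nrm v by rewrite nrm_gt0.
pose q := nrm v / rho.
have q01 : 0 <= q <= 1.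
  by rewrite /q divr_ge0 ?nrm_ge0 ?ltW//= ltr_pdivrMr// mul1r.
(* A lower bound for the large partial sums: since [nrm v = rho * q] with [q <= 1], the terms after
   [k] add up to at most [M * q ^+ k.+1]. *)
pose del := nrm (c k) * nrm v ^+ k - M * q ^+ k.+1.
have del0 : 0 < del.
  rewrite /del subr_gt0 /q expr_div_n mulrA ltr_pdivrMr ?exprn_gt0//.
  rewrite [nrm v ^+ k.+1]exprS mulrCA mulrA -mulrA [ltRHS]mulrAC -subr_gt0.
  rewrite [ltRHS](_ : _ = (nrm (c k) * rho ^+ k.+1 - nrm v * M) * nrm v ^+ k); last by ring.
  rewrite mulr_gt0 ?exprn_gt0// subr_gt0; apply: le_lt_trans vck.
  by rewrite ler_wpM2l ?nrm_ge0//; lra.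
have vr : nrm v < r by apply: lt_trans vrho _; rewrite /rho; lra.
have /cvg_nrmP/(_ del del0) := cF v vr.
rewrite Fv => vcv; near \oo => n.
have : nrm (series (fun k => c k * v ^+ k) n) < del.
  by rewrite -nrmN -[- _]add0r; near: n.
apply/negP; rewrite -leNgt.
have kn : (k < n)%N by near: n; exact: nbhs_infty_gt.
rewrite /series/= (big_cat_nat (n := k.+1))//= big_nat_recr//= big1_seq ?add0r; last first.
  by move=> i; rewrite mem_index_iota => /andP[_ /andP[_ ik]]; rewrite ihk// mul0r.
rewrite /del.
set T := \sum_(_ <= _ < _) _.
have TM : nrm T <= M * q ^+ k.+1.
  apply: (@le_trans _ _ (\sum_(k.+1 <= i < n) nrm (c i * v ^+ i))).
    rewrite /T; elim/big_ind2: _ => [|x1 x2 y1 y2 h1 h2|//]; first by rewrite nrm0.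
    by apply: le_trans (le_nrmD _ _) _; exact: lerD.
  apply: (@le_trans _ _ (\sum_(k.+1 <= i < n) (nrm (c i) * rho ^+ i * q ^+ k.+1))).
    rewrite big_nat_cond [leRHS]big_nat_cond.
    apply: ler_sum => i /andP[/andP[ki _] _].
    rewrite nrmM nrmX -mulrA ler_wpM2l ?nrm_ge0//.
    rewrite -(subnKC ki) (_ : nrm v = rho * q); last by rewrite /q; field; lra.
    rewrite exprMn ler_wpM2l ?exprn_ge0 ?(ltW rho0)//.
    rewrite exprD ler_piMr ?exprn_ge0//; first by case/andP: q01.
    by apply: exprn_ile1; case/andP: q01.
  rewrite -mulr_suml ler_wpM2r ?exprn_ge0//; first by case/andP: q01.
  apply: le_trans (MP n); rewrite /series/= [leRHS](big_cat_nat (n := k.+1))//=.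
  by rewrite lerDr sumr_ge0// => i _; rewrite mulr_ge0 ?nrm_ge0 ?exprn_ge0// ltW.
have := le_nrmD (c k * v ^+ k + T) (- T).
rewrite addrK nrmN nrmM nrmX => h; lra.
Unshelve. all: by end_near. Qed.

Lemma analytic_zeros f z : analytic_at f z ->
  (forall e : R, 0 < e -> exists w, [/\ w != z, nrm (w - z) < e & f w = 0]) ->
  exists2 r : R, 0 < r & forall w, nrm (w - z) < r -> f w = 0.
Proof.
move=> /analytic_atP[r [c [r0 cf]]] zf; exists r => // w wz.
have c0 : forall k, c k = 0.
  apply: (power_series_zeros (F := fun v => f (z + v)) r0) => [v vr|e e0].
    by have := cf (z + v); rewrite [_ - z]addrC addKr; apply.
  have [v [vz ve fv]] := zf e e0; exists (v - z).
  by rewrite subr_eq0 addrCA subrr addr0; split.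
apply: (@cvgC_unique _ _ _ _ (cf w wz)).
rewrite (_ : series _ = fun=> 0).
  by apply/cvg_nrmP => e e0; apply: nearW => n; rewrite subrr nrm0.
by apply/funext => n; rewrite /series/= big1// => i _; rewrite c0 mul0r.
Qed.

Lemma eq_analytic_at f g z (e : R) : 0 < e ->
  (forall w, nrm (w - z) < e -> f w = g w) -> analytic_at g z -> analytic_at f z.
Proof.
move=> e0 fg /analytic_atP[r [c [r0 cg]]]; apply/analytic_atP.
exists (Num.min r e), c; rewrite lt_min r0 e0; split => [//|w].
by rewrite lt_min => /andP[wr we]; rewrite fg//; exact: cg.
Qed.

Lemma analytic_atD f g z : analytic_at f z -> analytic_at g z ->
  analytic_at (fun w => f w + g w) z.
Proof.
move=> /analytic_atP[r [c [r0 cf]]] /analytic_atP[s [d [s0 dg]]]; apply/analytic_atP.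
exists (Num.min r s), (fun k => c k + d k); rewrite lt_min r0 s0; split => [//|w].
rewrite lt_min => /andP[/cf wr /dg ws].
have -> : (fun k => (c k + d k) * (w - z) ^+ k) =
    (fun k => c k * (w - z) ^+ k + d k * (w - z) ^+ k).
  by apply/funext => k; rewrite mulrDl.
exact: seriesCD wr ws.
Qed.

Lemma analytic_atZ f z a : analytic_at f z -> analytic_at (fun w => a * f w) z.
Proof.
move=> /analytic_atP[r [c [r0 cf]]].
apply/analytic_atP.
exists r, (fun k => a * c k).
split => [//|w /cf wr].
have -> : (fun k => a * c k * (w - z) ^+ k) = (fun k => a * (c k * (w - z) ^+ k)).
  by apply/funext => k; rewrite mulrA.
exact: (seriesCZ a wr).
Qed.

Lemma analytic_atB f g z : analytic_at f z -> analytic_at g z ->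
  analytic_at (fun w => f w - g w) z.
Proof.
move=> fz /(analytic_atZ (-1)) gz; apply: eq_analytic_at ltr01 _ (analytic_atD fz gz).
by move=> w _; rewrite mulN1r.
Qed.

(** As [w - a = (w - z) + (z - a)], only the factor [w - z] matters, and it shifts the coefficients
    by one. *)
Lemma analytic_at_mulX f z a : analytic_at f z ->
  analytic_at (fun w => (w - a) * f w) z.
Proof.
move=> /analytic_atP[r [c [r0 cf]]].
suff h : analytic_at (fun w => (w - z) * f w) z.
  have fz : analytic_at f z by apply/analytic_atP; exists r, c.
  apply: eq_analytic_at ltr01 _ (analytic_atD h (analytic_atZ (z - a) fz)).
  by move=> w _; ring.
apply/analytic_atP; exists r, (fun k => if k is k'.+1 then c k' else 0).
split => [//|w /cf /(seriesCZ (w - z)) h].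
apply/cvg_nrmP => e e0; move/cvg_nrmP: h => /(_ e e0)[N _ hN].
exists N.+1 => // -[//|n] /= Nn; have := hN n Nn.
congr (nrm (_ - _) < e); rewrite /series/= big_nat_recl//= mul0r add0r.
by apply: eq_bigr => i _; rewrite exprS mulrCA.
Qed.

(** Expand [(a + v) ^+ k] by the binomial formula and exchange the sums. With [v1] half the distance
    from [w0] to the circle, the double series is dominated by [nrm (c k) * (nrm a + v1) ^+ k],
    which is summable. *)
Lemma power_series_recenter c f z w0 (r : R) :
  (forall w, nrm (w - z) < r ->
    series (fun k => c k * (w - z) ^+ k) @ \oo --> (f w : R[i]^o)) ->
  nrm (w0 - z) < r -> analytic_at f w0.
Proof.
move=> cf w0r; set a := w0 - z in w0r *; pose v1 : R := (r - nrm a) / 2.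
have a0 := nrm_ge0 a.
have v10 : 0 < v1 by rewrite /v1; lra.
have [||M MP] := @power_series_abs_bounded c r (nrm a + v1).
- move=> w wr; exists (f (z + w)).
  by have := cf (z + w); rewrite [_ - z]addrC addKr; apply.
- by rewrite /v1; lra.
pose F v k j : R[i] := c k * (a ^+ (k - j) * v ^+ j *+ 'C(k, j)).
have sF : abs_summable (fun p => nrm (F v1%:C p.1 p.2)).
  apply: (@abs_summable2 _ (fun i j => nrm (F v1%:C i j)) _ M) MP => k n.
  apply: le_trans (finite_series_le (N := k.+1) _ _ _) _ => // [j kj|].
    by rewrite /F bin_small// mulr0n mulr0 nrm0 normr0.
  rewrite exprDn mulr_sumr; apply: ler_sum => j _.
  rewrite ger0_norm ?nrm_ge0// /F nrmM ler_wpM2l ?nrm_ge0//.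
  by rewrite -mulr_natr nrmM -(rmorph_nat (real_complex R)) nrmR nrmM !nrmX nrmR normr_nat mulr_natr gtr0_norm.
have [_ [d [_ [_ dP _ _]]]] := fubiniC sF.
(* The column sums [d j] were taken at [v = v1], hence the division by [v1 ^+ j]. *)
apply/analytic_atP; exists v1, (fun j => d j / v1%:C ^+ j); split => [//|w wv].
set v := w - w0 in wv *.
have v1C0 : v1%:C != 0 :> R[i] by rewrite -nrm_gt0 nrmR normr_gt0 gt_eqF.
have FE k j : F v k j = (v / v1%:C) ^+ j * F v1%:C k j.
  rewrite /F !mulrnAr; congr (_ *+ _); rewrite -[in LHS](divfK v1C0 v) exprMn.
  by move: (c k) (a ^+ _) (_ ^+ j) (v1%:C ^+ j) => x1 x2 x3 x4; ring.
have fw : f w = f (z + (a + v)) by congr f; rewrite /a /v; ring.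
apply: (@fubiniC_swap (F v) (fun k => c k * (a + v) ^+ k)).
- apply: le_abs_summable sF => -[k j]/=; rewrite FE nrmM !ger0_norm ?mulr_ge0 ?nrm_ge0//.
  rewrite ler_piMl ?nrm_ge0// nrmX exprn_ile1 ?nrm_ge0// nrmM nrmV nrmR gtr0_norm//.
  by rewrite ler_pdivrMr// mul1r ltW.
- move=> k; rewrite exprDn mulr_sumr.
  by apply: seriesC_fin => j kj; rewrite /F bin_small// mulr0n mulr0.
- move=> j; have -> : (F v)^~ j = (fun k => (v / v1%:C) ^+ j * F v1%:C k j).
    by apply/funext => k; rewrite FE.
  rewrite (_ : d j / _ * _ = (v / v1%:C) ^+ j * d j); first exact: (seriesCZ _ (dP j)).
  by rewrite expr_div_n; field; rewrite expf_neq0.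
- have := cf (z + (a + v)); rewrite fw [_ - z]addrC addKr; apply.
  by apply: le_lt_trans (le_nrmD _ _) _; move: wv; rewrite /v1; lra.
Qed.

(* The supremum of the times up to which f vanishes along the segment is a
   limit of zeros, so that f vanishes around it. *)
Lemma analytic_segment_zero f a b (e : R) : a != b -> 0 < e ->
  (forall t : R, 0 <= t <= 1 -> analytic_at f (a + t%:C * (b - a))) ->
  (forall w, nrm (w - a) < e -> f w = 0) -> f b = 0.
Proof.
have minP (x y : R) : 0 < x -> 0 < y ->
    [/\ 0 < Num.min x (y / 2), Num.min x (y / 2) <= x & Num.min x (y / 2) < y].
  by move=> x0 y0; case: (leP x (y / 2)) => h; split; lra.
move=> ab e0 fan fa; pose p (t : R) := a + t%:C * (b - a).
pose L := nrm (b - a).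
have L0 : 0 < L by rewrite /L nrm_gt0 subr_eq0 eq_sym.
have pd t s : nrm (p t - p s) = `|t - s| * L.
  rewrite /p (_ : _ - _ = (t - s)%:C * (b - a)); last by rewrite rmorphB/=; ring.
  by rewrite nrmM nrmR.
have p0 : p 0 = a by rewrite /p mul0r addr0.
have p1 : p 1 = b by rewrite /p mul1r addrC subrK.
pose S := [set t : R | 0 <= t <= 1 /\ forall s, 0 <= s <= t -> f (p s) = 0].
have near0 s : 0 <= s < e / L -> f (p s) = 0.
  move=> /andP[s0 se]; apply: fa; rewrite -p0 pd subr0 ger0_norm//.
  by rewrite -ltr_pdivlMr.
have eL0 : 0 < e / L by rewrite divr_gt0.
pose t1 := Num.min 1 (e / L / 2).
have t1P : [/\ 0 < t1, t1 <= 1 & t1 < e / L].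
  exact: minP.
have St1 : S t1.
  split => [|s s1]; first by case: t1P => *; lra.
  by apply: near0; case: t1P => *; lra.
have supS : has_sup S.
  by split; [exists t1|exists 1 => t [/andP[]]].
have t1S : t1 <= sup S by apply: ub_le_sup => //; case: supS.
have S1 : sup S <= 1 by apply: ge_sup => [|t [/andP[]]//]; exists t1.
have Sz s : 0 <= s < sup S -> f (p s) = 0.
  move=> /andP[s0 sS]; have ss : 0 < sup S - s by lra.
  have [t [_ tz] st] := sup_adherent ss supS.
  by apply: tz; move: st; rewrite opprB addrC subrK => st; lra.
have [||e' e'0 e'z] := @analytic_zeros f (p (sup S)).
- by apply: fan; case: t1P => *; lra.
- move=> d d0; pose h := Num.min (t1 / 2) (d / L / 2).
  have dL : 0 < d / L by rewrite divr_gt0.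
  have [h0 ht hd] : [/\ 0 < h, h <= t1 / 2 & h < d / L].
    by apply: minP => //; case: t1P => *; lra.
  have hn : nrm (p (sup S - h) - p (sup S)) = h * L.
    by rewrite pd addrAC subrr add0r normrN gtr0_norm.
  exists (p (sup S - h)); split.
  + by rewrite -subr_eq0 -nrm_eq0 hn mulf_neq0// gt_eqF.
  + by rewrite hn -ltr_pdivlMr.
  + by apply: Sz; case: t1P => *; lra.
have [S1'|S1'] := eqVneq (sup S) 1.
  by rewrite -p1 -S1'; apply: e'z; rewrite subrr nrm0.
exfalso; have e'L : 0 < e' / L by rewrite divr_gt0.
have {}S1' : sup S < 1 by rewrite lt_neqAle S1'.
pose h := Num.min (1 - sup S) (e' / L / 2).
have [h0 h1 he] : [/\ 0 < h, h <= 1 - sup S & h < e' / L].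
  by apply: minP => //; lra.
have : S (sup S + h).
  split; first by case: t1P => *; lra.
  move=> s /andP[s0 sh]; have [sS|sS] := ltP s (sup S); first by apply: Sz; lra.
  apply: e'z; rewrite pd ger0_norm; last lra.
  by rewrite -ltr_pdivlMr//; lra.
move=> /(ub_le_sup (proj2 supS)); lra.
Qed.

End analytic_functions.

(** * The power series of the complex exponential *)

Section complex_exponential.
Variable R : realType.
Implicit Types (z w : R[i]) (x y : R).

Lemma expCD z w : expC (z + w) = expC z * expC w.
Proof.
case: z => a b; case: w => c d; rewrite /expC/=; apply/eqP.
by rewrite eq_complex/= expRD cosD sinD; apply/andP; split; apply/eqP; ring.
Qed.

Lemma expC_real x : expC x%:C = (expR x)%:C.
Proof. by rewrite /expC/= cos0 sin0 mulr1 mulr0. Qed.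

Lemma nrm_expC z : nrm (expC z) = expR (complex.Re z).
Proof.
rewrite /nrm normc_def/= !exprMn -mulrDr cos2Dsin2 mulr1.
by rewrite sqrtr_sqr ger0_norm ?expR_ge0.
Qed.

Lemma series_exp x : series (fun k => x ^+ k / k`!%:R) @ \oo --> expR x.
Proof. exact: (is_cvg_series_exp_coeff x). Qed.

Lemma series_exp_le x n : 0 <= x -> series (fun k => x ^+ k / k`!%:R) n <= expR x.
Proof.
move=> x0; apply: series_le_lim => [k|]; last exact: series_exp.
by rewrite divr_ge0 ?exprn_ge0.
Qed.

Lemma Re_iX k : complex.Re ('i ^+ k : R[i]) = (~~ odd k)%:R * (-1) ^+ k./2 /\
  complex.Im ('i ^+ k : R[i]) = (odd k)%:R * (-1) ^+ k.-1./2.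
Proof.
have i2 m : 'i ^+ m.*2 = ((-1) ^+ m)%:C :> R[i].
  by rewrite -mul2n exprM sqr_i rmorphXn/= rmorphN.
have := odd_double_half k; case: (odd k) => /= <-; last first.
  by rewrite add0n i2 doubleK mul0r mul1r.
by rewrite add1n /= uphalf_double doubleK exprS i2 mul0r mul1r ReM ImM/=; lra.
Qed.

Lemma Re_iMX y k : complex.Re (('i * y%:C) ^+ k) = complex.Re ('i ^+ k : R[i]) * y ^+ k /\
  complex.Im (('i * y%:C) ^+ k) = complex.Im ('i ^+ k : R[i]) * y ^+ k.
Proof.
by rewrite exprMn -rmorphXn ReM ImM /= mulr0 mulr0 subr0 add0r.
Qed.

Lemma ReMr z x : complex.Re (z * x%:C) = complex.Re z * x.
Proof. by rewrite ReM/= mulr0 subr0. Qed.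

Lemma ImMr z x : complex.Im (z * x%:C) = complex.Im z * x.
Proof. by rewrite ImM/= mulr0 add0r. Qed.

Lemma expCi y : expC ('i * y%:C) = cos y +i* sin y.
Proof.
have -> : 'i * y%:C = 0 +i* y :> R[i].
  by apply/eqP; rewrite eq_complex ReM ImM/=; apply/andP; split; apply/eqP; ring.
by rewrite /expC/= expR0 !mul1r.
Qed.

Lemma series_expCi y :
  series (fun k => ('i * y%:C) ^+ k * (k`!%:R^-1)%:C) @ \oo --> (expC ('i * y%:C) : R[i]^o).
Proof.
rewrite expCi; apply/seriesC_P; split => /=.
  rewrite (_ : (fun n => _) = cos_coeff y).
    by rewrite cos.unlock; exact: is_cvg_series_cos_coeff.
  apply/funext => k; rewrite ReMr (Re_iMX y k).1 (Re_iX k).1 cos_coeffE/=.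
  by rewrite mulrAC.
rewrite (_ : (fun n => _) = sin_coeff y).
  by rewrite sin.unlock; exact: is_cvg_series_sin_coeff.
apply/funext => k; rewrite ImMr (Re_iMX y k).2 (Re_iX k).2 sin_coeffE/=.
by rewrite mulrAC.
Qed.

Lemma seriesC_shift (F : nat -> R[i]) (s : R[i]) j : series F @ \oo --> (s : R[i]^o) ->
  series (fun k => if (j <= k)%N then F (k - j)%N else 0) @ \oo --> (s : R[i]^o).
Proof.
move=> /cvg_nrmP Fs; apply/cvg_nrmP => e /Fs[N _ hN].
exists (N + j)%N => // n /= Nn.
have jn : (j <= n)%N by apply: leq_trans Nn; rewrite leq_addl.
have := hN (n - j)%N; rewrite /= leq_subRL// addnC => /(_ Nn).
congr (nrm (_ - _) < e); rewrite /series/= [RHS](big_cat_nat (n := j))//= [X in _ = X + _]big1_seq ?add0r; last first.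
  by move=> i; rewrite mem_index_iota => /andP[_ /andP[_ ij]]; rewrite leqNgt ij.
rewrite -{2}[j]add0n big_addn; apply: eq_bigr => i _.
by rewrite leq_addl addnK.
Qed.

(** Cauchy product of the series of [exp x] and [exp ('i * y)]: the row [j] of [F] is [B j] times
    the series [A] delayed by [j], and by the binomial formula the column [k] sums to
    [z ^+ k / k!]. *)
Lemma series_expC z :
  series (fun k => z ^+ k * (k`!%:R^-1)%:C) @ \oo --> (expC z : R[i]^o).
Proof.
pose x := complex.Re z; pose y := complex.Im z.
have zE : z = x%:C + 'i * y%:C by rewrite -complexE.
pose A k : R[i] := x%:C ^+ k * (k`!%:R^-1)%:C.
pose B k : R[i] := ('i * y%:C) ^+ k * (k`!%:R^-1)%:C.
pose F j k := B j * (if (j <= k)%N then A (k - j)%N else 0).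
have nA k : nrm (A k) = `|x| ^+ k / k`!%:R.
  by rewrite nrmM nrmX !nrmR [X in _ * X]ger0_norm// invr_ge0.
have nB k : nrm (B k) = `|y| ^+ k / k`!%:R.
  by rewrite nrmM nrmX nrmM nrm_i mul1r !nrmR [X in _ * X]ger0_norm// invr_ge0.
have sA : series A @ \oo --> ((expR x)%:C : R[i]^o).
  apply/seriesC_P; split => /=.
    rewrite (_ : (fun n => _) = fun k => x ^+ k / k`!%:R); first exact: series_exp.
    by apply/funext => k; rewrite /A -rmorphXn -rmorphM.
  rewrite (_ : (fun n => _) = fun=> 0); last first.
    by apply/funext => k; rewrite /A -rmorphXn -rmorphM.
  rewrite (_ : series _ = fun=> 0); first exact: cvg_cst.
  by apply/funext => n; rewrite /series/= big1.
have Fsum : abs_summable (fun p : nat * nat => nrm (F p.1 p.2)).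
  apply: (@abs_summable2 _ (fun i j => nrm (F i j)) (fun j => expR `|x| * (`|y| ^+ j / j`!%:R))
           (expR `|x| * expR `|y|)) => [j n|n]; last first.
    by rewrite /series/= -mulr_sumr ler_wpM2l ?expR_ge0//; exact: series_exp_le.
  rewrite /series/= /F (eq_bigr (fun k => `|y| ^+ j / j`!%:R *
      (if (j <= k)%N then `|x| ^+ (k - j) / (k - j)`!%:R else 0))); last first.
    move=> k _; rewrite ger0_norm ?nrm_ge0// nrmM nB.
    by case: ifP => _; rewrite ?nA ?nrm0.
  rewrite -mulr_sumr mulrC ler_wpM2r ?divr_ge0 ?exprn_ge0//.
  have [jn|nj] := leqP j n; last first.
    rewrite big1_seq ?expR_ge0// => i; rewrite mem_index_iota => /andP[_ /andP[_ ij]].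
    by rewrite leqNgt (ltn_trans ij nj).
  rewrite (big_cat_nat (n := j))//= big1_seq ?add0r; last first.
    by move=> i; rewrite mem_index_iota => /andP[_ /andP[_ ij]]; rewrite leqNgt ij.
  rewrite -{1}[j]add0n big_addn; apply: le_trans (series_exp_le (n - j) (normr_ge0 x)).
  by rewrite /series/=; under eq_bigr do rewrite leq_addl addnK.
have -> : expC z = (expR x)%:C * expC ('i * y%:C) by rewrite zE expCD expC_real.
apply: (@fubiniC_swap _ F (fun j => (expR x)%:C * B j) _ _ Fsum).
- by move=> j; rewrite mulrC; exact: (seriesCZ (B j) (seriesC_shift j sA)).
- move=> k; rewrite zE exprDn mulr_suml.
  rewrite (eq_bigr (fun i : 'I_k.+1 => F i k)); last first.
    move=> i _; have ik : (i <= k)%N by rewrite -ltnS.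
    rewrite /F ik /A /B.
    have -> : (k`!%:R^-1)%:C = (i`!%:R^-1)%:C * ((k - i)`!%:R^-1)%:C * 'C(k, i)%:R^-1 :> R[i].
      rewrite -(rmorph_nat (real_complex R)) -fmorphV -!rmorphM; congr _%:C.
      by rewrite -(bin_fact ik) !natrM !invfM; ring.
    have C0 : 'C(k, i)%:R != 0 :> R[i] by rewrite pnatr_eq0 -lt0n bin_gt0.
    rewrite -[(_ * _) *+ _]mulr_natr; move: C0.
    set x1 := x%:C ^+ _; set x2 := ('i * y%:C) ^+ _; set x3 := (i`!%:R^-1)%:C.
    set x4 := ((k - i)`!%:R^-1)%:C; set x5 := 'C(k, i)%:R => C0.
    transitivity (x2 * x3 * (x1 * x4) * (x5 / x5)); last by rewrite divff// mulr1.
    by move: x1 x2 x3 x4 x5 {C0} => x1 x2 x3 x4 x5; ring.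
  by apply: seriesC_fin => j kj; rewrite /F leqNgt kj mulr0.
- exact: (seriesCZ _ (@series_expCi y)).
Qed.

End complex_exponential.
Arguments series_expC {R} z.
Arguments series_exp {R} x.

(** * The pole of zeta *)

Section zeta_near_one.
Variable R : realType.
Implicit Types (z w : R[i]) (x y : R) (n k : nat).

Let m n : R := n.+1%:R.
Let L n : R := ln (m n).
Let s n : R := expR (L n / 2).

Let m_gt0 n : 0 < m n. Proof. by rewrite /m ltr0n. Qed.

Let L_ge0 n : 0 <= L n. Proof. by rewrite /L ln_ge0// /m ler1n. Qed.

Let s_gt0 n : 0 < s n. Proof. exact: expR_gt0. Qed.

Let sqr_s n : s n ^+ 2 = m n.
Proof.
by rewrite /s expr2 -expRD -splitr /L lnK// posrE.
Qed.

Let mS n : m n.+1 = m n + 1. Proof. by rewrite /m [in LHS]mulrS addrC. Qed.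

Let L_diff n : (m n + 1)^-1 <= L n.+1 - L n <= (m n)^-1.
Proof.
have m0 := m_gt0 n; have m1 := m_gt0 n.+1; rewrite mS in m1.
apply/andP; split.
  have -> : L n.+1 - L n = - ln (1 + - (m n + 1)^-1).
    rewrite (_ : 1 + _ = m n / m n.+1); last by rewrite mS; field; rewrite gt_eqF.
    by rewrite ln_div ?posrE// opprB.
  rewrite lerNr le_ln1Dx// ltrN2 invf_lt1//; lra.
have -> : L n.+1 - L n = ln (1 + (m n)^-1).
  rewrite (_ : 1 + _ = m n.+1 / m n); last by rewrite mS; field; rewrite gt_eqF.
  by rewrite ln_div ?posrE.
by rewrite le_ln1Dx// (@lt_trans _ _ 0) ?invr_gt0//; lra.
Qed.

(** The coefficients of [w] times the power series with coefficients [F]. *)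
Let sh (F : nat -> R) k := if (1 <= k)%N then F (k - 1)%N else 0.

(* The coefficients of [w / m - 1 + (1 + 1 / m) ^ (- w)] multiplied by
   [m ^ (- w)], with [m = n + 1]. *)
Let cn n k : R := sh (fun k => (- L n) ^+ k / k`!%:R) k / m n -
  (- L n) ^+ k / k`!%:R + (- L n.+1) ^+ k / k`!%:R.

(** With [m = n + 1] this is [w * m ^ (-1 - w) - m ^ (- w) + (m + 1) ^ (- w)]. The telescoping
    difference cancels the leading part of the first term, which leaves order [m ^ (-2 - w)] and
    hence convergence beyond [Re w = 0]. *)
Let un n w : R[i] := ((m n)^-1)%:C * (w * expC ((- L n)%:C * w)) -
  expC ((- L n)%:C * w) + expC ((- L n.+1)%:C * w).

Let series_un n w :
  series (fun k => (cn n k)%:C * w ^+ k) @ \oo --> (un n w : R[i]^o).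
Proof.
pose E a k : R[i] := ((- L a)%:C * w) ^+ k * (k`!%:R^-1)%:C.
have h1 := seriesCZ ((m n)^-1)%:C (seriesC_shift 1 (seriesCZ w (series_expC ((- L n)%:C * w)))).
have h2 := seriesCZ (-1) (series_expC ((- L n)%:C * w)).
have h := seriesCD (seriesCD h1 h2) (series_expC ((- L n.+1)%:C * w)).
rewrite mulN1r in h; rewrite /un.
set f := (X in series X @ _); rewrite (_ : f = (fun k => ((m n)^-1)%:C *
  (if (1 <= k)%N then w * E n (k - 1)%N else 0) + (-1) * E n k + E n.+1 k)); first exact: h.
apply/funext => k; rewrite /f /cn /E !exprMn -!rmorphXn !rmorphD/= rmorphN/= !rmorphM/=.
case: k => [|k]; rewrite /sh/=; first by rewrite rmorph0 mul0r mulr0 expr0; ring.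
rewrite subn1/= [w ^+ k.+1]exprS [(_ / k`!%:R)%:C]rmorphM/=.
move: (_ ^-1)%:C (_ ^-1)%:C (_ ^-1)%:C (w ^+ k) => x1 x2 x3 x4.
move: ((- L n) ^+ k)%:C ((- L n) ^+ k.+1)%:C ((- L n.+1) ^+ k.+1)%:C => x5 x6 x7.
by ring.
Qed.

(** Up to sign, [cn n k] is [D - P / m n]. Both [D] and [P / m n] are at least [(L n.+1 - L n) * P],
    and the bound is the sum of their distances to it. *)
Let cn_le n k : `|cn n k| <=
  (L n.+1 ^+ k - L n ^+ k) / k`!%:R +
  ((m n)^-1 - 2 * (L n.+1 - L n)) * sh (fun k => L n ^+ k / k`!%:R) k.
Proof.
have /andP[dl du] := L_diff n.
have d0 : 0 <= L n.+1 - L n by apply: le_trans dl; rewrite invr_ge0; have := m_gt0 n; lra.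
have L0 := L_ge0 n.
set P := sh _ k; set D := (_ - _) / _.
have P0 : 0 <= P by rewrite /P /sh; case: ifP => // _; rewrite divr_ge0 ?exprn_ge0.
(* This is the tangent inequality [(k + 1) * d * L ^ k <= (L + d) ^ (k + 1) - L ^ (k + 1)] divided
   by [(k + 1)!], proved by induction on [k]. *)
have DP : (L n.+1 - L n) * P <= D.
  rewrite /P /D /sh; case: k {P P0 D} => [|k] /=; first by rewrite !expr0 subrr mul0r mulr0.
  rewrite subn1 /= ler_pdivlMr ?ltr0n ?fact_gt0// factS natrM.
  set d := L n.+1 - L n in dl du d0 *.
  have -> : L n.+1 = L n + d by rewrite /d addrC subrK.
  have -> : d * (L n ^+ k / k`!%:R) * (k.+1%:R * k`!%:R) = d * (k.+1%:R * L n ^+ k).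
    by field; rewrite pnatr_eq0 -lt0n fact_gt0.
  elim: k => [|k ih]; first by rewrite expr0 !expr1; lra.
  rewrite [L n ^+ k.+1 in leLHS]exprS [L n ^+ k.+2]exprS [(L n + d) ^+ k.+2]exprS.
  have Lk : L n ^+ k.+1 <= (L n + d) ^+ k.+1 by rewrite lerXn2r ?nnegrE; lra.
  have e1 : d * (k.+2%:R * (L n * L n ^+ k)) = L n * (d * (k.+1%:R * L n ^+ k)) + d * L n ^+ k.+1.
    by rewrite [k.+2%:R]mulrS exprS; ring.
  have h1 := ler_wpM2l L0 ih; have h2 := ler_wpM2l d0 Lk.
  rewrite e1; move: h1 h2; rewrite mulrBr [L n * L n ^+ k.+1]mulrC.
  by move: (_ ^+ _) (_ ^+ _) => a b h1 h2; lra.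
have -> : `|cn n k| = `|D - P / m n|.
  rewrite /cn /D /P.
  have NX x j : (- x) ^+ j = (-1) ^+ j * x ^+ j :> R by rewrite -exprMn mulN1r.
  have -> : sh (fun k => (- L n) ^+ k / k`!%:R) k = - (-1) ^+ k * sh (fun k => L n ^+ k / k`!%:R) k.
    case: k {P P0 D DP} => [|k]; rewrite /sh/=; first by rewrite mulr0.
    by rewrite subn1/= NX exprS mulN1r opprK mulrA.
  rewrite (NX (L n)) (NX (L n.+1)); set P' := sh _ k.
  rewrite (_ : _ + _ = (-1) ^+ k * ((L n.+1 ^+ k - L n ^+ k) / k`!%:R - P' / m n)); last by ring.
  by rewrite normrM normrX normrN1 expr1n mul1r.
have -> : D - P / m n = (D - (L n.+1 - L n) * P) - ((m n)^-1 - (L n.+1 - L n)) * P by ring.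
apply: le_trans (ler_normB _ _) _; rewrite !ger0_norm ?subr_ge0 ?mulr_ge0 ?subr_ge0//.
by move: P P0 {DP} => P P0; rewrite le_eqVlt; apply/orP; left; apply/eqP; ring.
Qed.

(* With [s n = sqrt (n + 1)], the sum of the bounds [cn_le] is at most
   [1 / (s n * s n.+1 ^+ 2)], and the right-hand side below telescopes. *)
Let cn_series_le n N :
  series (fun k => `|cn n k| * 2^-1 ^+ k) N <= 2 * ((s n)^-1 - (s n.+1)^-1).
Proof.
pose g k := (L n.+1 ^+ k - L n ^+ k) / k`!%:R +
  ((m n)^-1 - 2 * (L n.+1 - L n)) * sh (fun k => L n ^+ k / k`!%:R) k.
have g0 k : 0 <= g k by apply: le_trans (cn_le n k).
have E a : series (fun k => L a ^+ k / k`!%:R * 2^-1 ^+ k) @ \oo --> s a.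
  rewrite (_ : (fun k => _) = (fun k => (L a / 2) ^+ k / k`!%:R)); first exact: series_exp.
  by apply/funext => k; rewrite exprMn; ring.
have Es : series (fun k => sh (fun k => L n ^+ k / k`!%:R) k * 2^-1 ^+ k) @ \oo --> 2^-1 * s n.
  rewrite -cvg_shiftS; set u := (X in X @ _ --> _).
  rewrite (_ : u = fun N => 2^-1 * series (fun k => L n ^+ k / k`!%:R * 2^-1 ^+ k) N).
    by apply: cvgM => //; exact: cvg_cst.
  apply/funext => M; rewrite /u /series/= big_nat_recl//= {1}/sh/= mul0r add0r mulr_sumr.
  by apply: eq_bigr => i _; rewrite /sh/= subn1/= exprS; ring.
(* At radius [1 / 2] the exponential series sum to [exp (L / 2)], that is to [s], so the sum of the
   bounds is explicit. *)
pose l := s n.+1 - s n + ((m n)^-1 - 2 * (L n.+1 - L n)) * (2^-1 * s n).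
have gl : series (fun k => g k * 2^-1 ^+ k) @ \oo --> l.
  rewrite (_ : series _ = fun N => series (fun k => L n.+1 ^+ k / k`!%:R * 2^-1 ^+ k) N -
     series (fun k => L n ^+ k / k`!%:R * 2^-1 ^+ k) N +
     ((m n)^-1 - 2 * (L n.+1 - L n)) *
     series (fun k => sh (fun k => L n ^+ k / k`!%:R) k * 2^-1 ^+ k) N).
    by apply: cvgD; [exact: cvgB|apply: cvgM => //; exact: cvg_cst].
  apply/funext => M; rewrite /series/= mulr_sumr -sumrB -big_split/=.
  by apply: eq_bigr => i _; rewrite /g; ring.
apply: (@le_trans _ _ (series (fun k => g k * 2^-1 ^+ k) N)).
  by rewrite /series/=; apply: ler_sum => k _; rewrite ler_wpM2r ?exprn_ge0 ?invr_ge0// cn_le.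
have /le_trans -> // : series (fun k => g k * 2^-1 ^+ k) N <= l.
  by apply: series_le_lim gl _ => k; rewrite mulr_ge0 ?exprn_ge0 ?invr_ge0.
have /andP[dl _] := L_diff n.
have a0 := s_gt0 n; have b0 := s_gt0 n.+1.
have ea := sqr_s n; have eb := sqr_s n.+1; rewrite mS -ea in eb.
rewrite /l -ea; rewrite -ea -eb in dl.
(* Here [b ^+ 2 = a ^+ 2 + 1] gives [b - a = 1 / (a + b) <= 1 / (2 * a)], and [d >= 1 / b ^+ 2].
   Hence [l <= 1 / a - a / b ^+ 2 = 1 / (a * b ^+ 2)], and [a + b <= 2 * b] compares this with
   [2 * (1 / a - 1 / b)]. *)
move: (s n) (s n.+1) (L n.+1 - L n) a0 b0 eb dl => a b d a0 b0 eb dl.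
have ab : a <= b by rewrite -(@ler_pXn2r _ 2) ?nnegrE ?ltW//; lra.
have h1 : b - a <= (2 * a)^-1.
  rewrite -[leRHS]mul1r ler_pdivlMr ?mulr_gt0//.
  have h : 1 = (b - a) * (b + a) by rewrite -subr_sqr eb; ring.
  by rewrite {2}h ler_wpM2l ?subr_ge0//; lra.
have h2 : a * (b ^+ 2)^-1 <= a * d by rewrite ler_wpM2l// ltW.
have h3 : (a * b ^+ 2)^-1 <= 2 * (a^-1 - b^-1).
  have -> : a^-1 - b^-1 = (b - a) / (a * b) by field; rewrite !gt_eqF.
  have hba : b - a = (b + a)^-1.
    apply: (mulIf (x := b + a)); first by rewrite gt_eqF// addr_gt0.
    by rewrite mulVf ?gt_eqF ?addr_gt0// -subr_sqr eb; ring.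
  rewrite hba -invfM -[2]invrK -invfM.
  rewrite lef_pV2 ?posrE ?mulr_gt0 ?exprn_gt0 ?addr_gt0 ?invr_gt0//.
  rewrite mulrA (_ : a * b ^+ 2 = b * (a * b)); last by ring.
  by rewrite ler_wpM2r ?mulr_ge0 ?(ltW a0) ?(ltW b0)//; lra.
apply: le_trans h3.
have -> : (a * b ^+ 2)^-1 = (2 * a)^-1 + (2 * a)^-1 - a * (b ^+ 2)^-1.
  rewrite [LHS](_ : _ = (b ^+ 2 - a ^+ 2) / (a * b ^+ 2)).
    by field; rewrite !gt_eqF.
  by rewrite eb addrAC subrr add0r mul1r.
have -> : (a ^+ 2)^-1 - 2 * d = 2 * ((2 * a ^+ 2)^-1 - d) by field; rewrite gt_eqF.
have -> : 2 * ((2 * a ^+ 2)^-1 - d) * (2^-1 * a) = (2 * a)^-1 - a * d by field; rewrite gt_eqF.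
lra.
Qed.

Let cn_summable : abs_summable (fun p : nat * nat => nrm ((cn p.1 p.2 * 2^-1 ^+ p.2)%:C)).
Proof.
apply: (@abs_summable2 _ (fun n k => nrm ((cn n k * 2^-1 ^+ k)%:C))
  (fun n => 2 * ((s n)^-1 - (s n.+1)^-1)) 2) => [n N|N].
  apply: le_trans (cn_series_le n N); rewrite /series/=; apply: ler_sum => k _.
  by rewrite ger0_norm ?nrm_ge0// nrmR normrM [X in _ * X]ger0_norm ?exprn_ge0 ?invr_ge0.
have -> : series (fun n => 2 * ((s n)^-1 - (s n.+1)^-1)) N = 2 * ((s 0)^-1 - (s N)^-1).
  rewrite /series/=; elim: N => [|N ih]; first by rewrite big_nil subrr mulr0.
  by rewrite big_nat_recr//= ih; ring.
have -> : s 0 = 1 by rewrite /s /L /m ln1 mul0r expR0.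
have sN : 0 < (s N)^-1 by rewrite invr_gt0.
by rewrite invr1; lra.
Qed.

(** Fubini for the terms [cn n k * w ^+ k]: the rows sum to [un n w] and the columns form a power
    series in [w]. The column sums [d k] are taken at [1 / 2], hence the coefficients
    [d k * 2 ^+ k]. *)
Let un_power_series : exists d : nat -> R[i], forall w, nrm w < 2^-1 ->
  exists S : R[i], series (fun k => d k * w ^+ k) @ \oo --> (S : R[i]^o) /\
                   series (fun n => un n w) @ \oo --> (S : R[i]^o).
Proof.
have [_ [d [_ [_ dP _ _]]]] :=
  @fubiniC _ (fun n k => (cn n k * 2^-1 ^+ k)%:C) cn_summable.
exists (fun k => d k * 2 ^+ k) => w w2.
have FE n k : (cn n k)%:C * w ^+ k = (2 * w) ^+ k * (cn n k * 2^-1 ^+ k)%:C.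
  rewrite rmorphM/= rmorphXn/= fmorphV/= rmorph_nat exprMn exprVn.
  have : 2 ^+ k != 0 :> R[i] by rewrite expf_neq0// pnatr_eq0.
  by move: (2 ^+ k) (w ^+ k) (cn n k)%:C => x1 x2 x3 h; field.
have sF : abs_summable (fun p : nat * nat => nrm ((cn p.1 p.2)%:C * w ^+ p.2)).
  apply: le_abs_summable cn_summable => -[n k]/=.
  rewrite FE nrmM !ger0_norm ?mulr_ge0 ?nrm_ge0// ler_piMl ?nrm_ge0//.
  rewrite nrmX exprn_ile1 ?nrm_ge0// nrmM.
  have -> : nrm (2 : R[i]) = 2 by rewrite -(rmorph_nat (real_complex R)) nrmR normr_nat.
  by rewrite -ler_pdivlMl// mulr1 ltW.
have [r [c [S [rP cP rS cS]]]] := @fubiniC _ (fun n k => (cn n k)%:C * w ^+ k) sF.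
exists S; split.
  rewrite (_ : (fun k => d k * 2 ^+ k * w ^+ k) = c)//.
  apply/funext => k.
  have E : (fun n => (cn n k)%:C * w ^+ k) =
           (fun n => (2 * w) ^+ k * (cn n k * 2^-1 ^+ k)%:C).
    by apply/funext => n; rewrite FE.
  have := cP k; rewrite /= E => cPk.
  rewrite -mulrA -exprMn mulrC; exact: cvgC_unique (seriesCZ _ (dP k)) cPk.
rewrite (_ : (fun n => un n w) = r)//.
by apply/funext => n; exact: cvgC_unique (@series_un n w) (rP n).
Qed.

(** The difference in [un] telescopes, so the partial sums are those of [w * zeta (1 + w)] plus
    [(N + 1) ^ (- w) - 1], and the power tends to 0 for [Re w > 0]. *)
Let un_zeta w (Z : R[i]) : 0 < complex.Re w ->
  series (fun n => expC (- (1 + w) * (ln n.+1%:R)%:C)) @ \oo --> (Z : R[i]^o) ->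
  series (fun n => un n w) @ \oo --> (w * Z - 1 : R[i]^o).
Proof.
move=> w0 /(seriesCZ w)/cvg_nrmP h; apply/cvg_nrmP => e e0.
have e20 : 0 < e / 2 by rewrite divr_gt0.
have [N1 _ hN1] := h _ e20.
have sumE N : series (fun n => un n w) N =
    series (fun n => w * expC (- (1 + w) * (ln n.+1%:R)%:C)) N - 1 + expC ((- L N)%:C * w).
  rewrite /series/=; elim: N => [|N ih].
    by rewrite !big_nil sub0r /L /m ln1 oppr0 mul0r expC_real expR0 addNr.
  rewrite !big_nat_recr//= ih /un.
  have -> : expC (- (1 + w) * (ln N.+1%:R)%:C) = ((m N)^-1)%:C * expC ((- L N)%:C * w).
    rewrite (_ : - (1 + w) * _ = (- L N)%:C + (- L N)%:C * w); last first.
      by rewrite /L /m rmorphN/=; ring.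
    by rewrite expCD expC_real expRN lnK// posrE.
  by ring.
near=> N; rewrite sumE.
rewrite (_ : _ - _ = (w * Z - series (fun n => w * expC (- (1 + w) * (ln n.+1%:R)%:C)) N) -
  expC ((- L N)%:C * w)); last by ring.
apply: le_lt_trans (le_nrmD _ _) _; rewrite [e]splitr nrmN ltrD//.
  by near: N; exists N1.
rewrite nrm_expC ReM/= mul0r subr0 mulNr expRN -[e / 2]invrK ltf_pV2 ?posrE ?invr_gt0 ?expR_gt0//.
rewrite -[X in X < _]lnK ?posrE ?invr_gt0// ltr_expR -ltr_pdivrMr// /L.
rewrite -[X in X < _]expRK ltr_ln ?posrE ?expR_gt0// /m.
near: N; exists (Num.bound (expR (ln (e / 2)^-1 / complex.Re w))) => // N /= bN.
apply: lt_trans (_ : (Num.bound (expR (ln (e / 2)^-1 / complex.Re w)))%:R < _).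
  by apply: archi_boundP; exact: expR_ge0.
by rewrite ltr_nat ltnS.
Unshelve. all: by end_near. Qed.

Lemma zeta_series_near_one (zeta : R[i] -> R[i]) :
  (forall z, 1 < complex.Re z ->
    series (fun n => expC (- z * (ln n.+1%:R)%:C)) @ \oo --> (zeta z : R[i]^o)) ->
  exists d : nat -> R[i], forall w, nrm w < 2^-1 ->
    exists S : R[i], series (fun k => d k * w ^+ k) @ \oo --> (S : R[i]^o) /\
      (0 < complex.Re w -> S = w * zeta (1 + w)).
Proof.
move=> hz; have [d dP] := un_power_series.
exists (fun k => (k == 0)%:R + d k) => w /dP[S [dS uS]]; exists (1 + S); split.
  have h1 : series (fun k => (k == 0)%:R * w ^+ k) @ \oo --> ((1 : R[i]) : R[i]^o).
    have h n : (1 <= n)%N -> (n == 0)%:R * w ^+ n = 0 :> R[i] by case: n => // n _; rewrite mul0r.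
    by have := seriesC_fin h; rewrite big_ord1 expr0 mulr1.
  rewrite (_ : (fun k => _) = (fun k => (k == 0)%:R * w ^+ k + d k * w ^+ k)).
    exact: seriesCD h1 dS.
  by apply/funext => k; rewrite mulrDl.
move=> w0; have w1 : 1 < complex.Re (1 + w) by rewrite ReD/=; lra.
by rewrite (cvgC_unique uS (un_zeta w0 (hz _ w1))); ring.
Qed.

End zeta_near_one.

(** * The entire function extending [(z - 1) * zeta z] *)

Section zeta_entire.
Variables (R : realType) (zeta : R[i] -> R[i]).
Hypothesis hzeta : is_riemann_zeta zeta.
Implicit Types (z w : R[i]) (t x y : R).

(** On the disc of radius [1 / 2] about 1, [D] measures the discrepancy between the function and the
    power series [G]. It vanishes for [Re z > 1], but is not known to be analytic at 1, so
    continuation must avoid that point: a segment from [5 / 4] does so when its end is not real, and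
    real points are limits of such ends. *)
Lemma zeta_mul_entire :
  exists h : R[i] -> R[i], (forall z, analytic_at h z) /\
    forall z, z != 1 -> h z = (z - 1) * zeta z.
Proof.
have [han hz] := hzeta.
have [d dP] := zeta_series_near_one hz.
have /choice[g gP] : forall w, exists S : R[i], nrm w < 2^-1 ->
    series (fun k => d k * w ^+ k) @ \oo --> (S : R[i]^o) /\
      (0 < complex.Re w -> S = w * zeta (1 + w)).
  move=> w; have [/dP[S SP]|] := ltP (nrm w) 2^-1; first by exists S.
  by exists 0.
pose G z := g (z - 1).
have Gser w : nrm (w - 1) < 2^-1 ->
    series (fun k => d k * (w - 1) ^+ k) @ \oo --> (G w : R[i]^o).
  by move=> /gP[].
have Gan z : nrm (z - 1) < 2^-1 -> analytic_at G z by exact: power_series_recenter Gser.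
pose D z := (z - 1) * zeta z - G z.
have Dan z : z != 1 -> nrm (z - 1) < 2^-1 -> analytic_at D z.
  by move=> z1 zn; apply: analytic_atB; [apply: analytic_at_mulX; exact: han|exact: Gan].
have D0 z : 1 < complex.Re z -> nrm (z - 1) < 2^-1 -> D z = 0.
  move=> z1 /gP[_]; rewrite ReB/= subr_gt0 => /(_ z1); rewrite /D /G => ->.
  by rewrite [1 + _]addrC subrK subrr.
(* The ball of radius [1 / 4] about [5 / 4] lies both in the disc and in [Re z > 1]. *)
pose a : R[i] := (5 / 4)%:C.
have a1 : nrm (a - 1) = 1 / 4.
  by rewrite /a -(rmorph1 (real_complex R)) -rmorphB nrmR ger0_norm; lra.
have Doff z : complex.Im z != 0 -> nrm (z - 1) < 2^-1 -> D z = 0.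
  move=> Iz zn; apply: (@analytic_segment_zero _ D a z (1 / 4)).
  - by apply: contraNneq Iz => <-.
  - by lra.
  - move=> t t01; apply: Dan.
      have [->|t0] := eqVneq t 0.
        by rewrite mul0r addr0 -subr_eq0 -nrm_eq0 a1 gt_eqF//; lra.
      apply: contraNneq t0 => /(congr1 (@complex.Im R)).
      rewrite ImD ImM ImB/= !mul0r subr0 !addr0 add0r => /eqP.
      by rewrite mulf_eq0 (negPf Iz) orbF.
    rewrite (_ : _ - 1 = (1 - t)%:C * (a - 1) + t%:C * (z - 1)); last first.
      by rewrite rmorphB/= rmorph1; ring.
    apply: le_lt_trans (le_nrmD _ _) _; rewrite !nrmM !nrmR a1 !ger0_norm; try lra.
    have [->|t0] := eqVneq t 0; first by rewrite mul0r; lra.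
    have t0' : 0 < t by rewrite lt0r t0; lra.
    have : t * nrm (z - 1) < t * 2^-1 by rewrite ltr_pM2l.
    by lra.
  - move=> w wa; apply: D0.
      have := normRe_le (w - a); rewrite ReB/= ler_norml => /andP[h _]; lra.
    have := le_nrmD (w - a) (a - 1); rewrite addrA subrK a1; lra.
(* A real [z] is approached vertically by the zeros [z + 'i * del], so [analytic_zeros] applies at
   [z] itself. *)
have Dz z : z != 1 -> nrm (z - 1) < 2^-1 -> D z = 0.
  move=> z1 zn; have [Iz|] := eqVneq (complex.Im z) 0; last by move=> ?; exact: Doff.
  have [|e e0 eP] := analytic_zeros (Dan z z1 zn); last by apply: eP; rewrite subrr nrm0.
  move=> e e0; pose del := Num.min e (2^-1 - nrm (z - 1)) / 2.
  have [del0 dele deln] : [/\ 0 < del, del < e & del < 2^-1 - nrm (z - 1)].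
    by rewrite /del; case: (leP e (2^-1 - nrm (z - 1))) => h; split; lra.
  have nd : nrm (z + 'i * del%:C - z) = del.
    by rewrite [_ - z]addrC addKr nrmM nrm_i mul1r nrmR gtr0_norm.
  exists (z + 'i * del%:C); rewrite nd; split => //.
    by rewrite -subr_eq0 -nrm_eq0 nd gt_eqF.
  apply: Doff; first by rewrite ImD ImM/= Iz mul1r mulr0 !add0r gt_eqF.
  have := le_nrmD (z + 'i * del%:C - z) (z - 1); rewrite addrA subrK nd; lra.
exists (fun z => if z == 1 then G 1 else (z - 1) * zeta z); split => [z|z /negPf->//].
have [->|z1] := eqVneq z 1.
  have h20 : (0 : R) < 2^-1 by rewrite invr_gt0.
  apply: (eq_analytic_at h20 _ (Gan 1 _)); last by rewrite subrr nrm0.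
  move=> w wn; case: (eqVneq w 1) => [->//|w1].
  by apply/eqP; rewrite -subr_eq0; apply/eqP; exact: Dz.
apply: (eq_analytic_at (e := nrm (z - 1)) _ _ (analytic_at_mulX 1 (han z z1))).
  by rewrite nrm_gt0 subr_eq0.
move=> w wz; case: (eqVneq w 1) => [w1|//].
by move: wz; rewrite w1 nrmB ltxx.
Qed.

End zeta_entire.

(** * Definable sets and terms *)

Section definability_calculus.
Variables (R : realType) (M : structure R).
Implicit Types (e : nat -> R) (t : term M) (phi : formula M).

Fixpoint subst_term (s : nat -> term M) t : term M :=
  match t with
  | TVar i => s i
  | TPar c => TPar M c
  | TApp _ _ pf ts => TApp pf (fun j => subst_term s (ts j))
  end.

(* [m] bounds the variables of the terms in the range of [s], so that the bound
   variable of the result, renamed [m], captures none of them. *)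
Fixpoint subst_formula (m : nat) (s : nat -> term M) phi : formula M :=
  match phi with
  | FEq t u => FEq (subst_term s t) (subst_term s u)
  | FRel _ _ pP ts => FRel pP (fun j => subst_term s (ts j))
  | FNot phi => FNot (subst_formula m s phi)
  | FAnd phi psi => FAnd (subst_formula m s phi) (subst_formula m s psi)
  | FExists i phi =>
      FExists m (subst_formula m.+1 (fun j => if j == i then TVar M m else s j) phi)
  end.

(** Expressed through evaluation rather than occurrence, which is the form needed when the bound
    variable [m] is overwritten. *)
Definition vars_below (m : nat) t := forall e e',
  (forall i, (i < m)%N -> e i = e' i) -> teval e t = teval e' t.

Lemma vars_belowW m m' t : (m <= m')%N -> vars_below m t -> vars_below m' t.
Proof. by move=> mm' h e e' ee'; apply: h => i im; apply: ee'; exact: leq_trans mm'. Qed.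

Lemma vars_below_bound n (ts : 'I_n -> term M) :
  (forall j, exists m, vars_below m (ts j)) -> exists m, forall j, vars_below m (ts j).
Proof.
move=> /choice[b bP]; exists (\max_j b j)%N => j.
by apply: vars_belowW (bP j); rewrite (leq_bigmax j).
Qed.

Lemma vars_below_exists t : exists m, vars_below m t.
Proof.
elim: t => [i|c|n f pf ts /vars_below_bound[m tm]].
- by exists i.+1 => e e'; apply.
- by exists 0%N.
- by exists m => e e' ee' /=; congr f; apply/rowP => j; rewrite !mxE; exact: tm.
Qed.

Lemma teval_subst e s t :
  teval e (subst_term s t) = teval (fun j => teval e (s j)) t.
Proof.
by elim: t => //= n f pf ts ih; congr f; apply/rowP => j; rewrite !mxE.
Qed.

Lemma holds_subst phi m s e : (forall j, vars_below m (s j)) ->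
  holds e (subst_formula m s phi) <-> holds (fun j => teval e (s j)) phi.
Proof.
elim: phi m s e => /= [t u|n P pP ts|phi ih|phi ih psi ih'|i phi ih] m s e sm.
- by rewrite !teval_subst.
- by rewrite (_ : (\row_j _) = \row_j teval (fun j => teval e (s j)) (ts j))//;
    apply/rowP => j; rewrite !mxE teval_subst.
- by have [h1 h2] := ih m s e sm; split => nh h; apply: nh; [exact: h2|exact: h1].
- have [h1 h2] := ih m s e sm; have [h3 h4] := ih' m s e sm.
  by split => -[h h']; split; auto.
- pose s' j := if j == i then TVar M m else s j.
  have sm' j : vars_below m.+1 (s' j).
    rewrite /s'; case: ifP => _; first by move=> e1 e2; apply.
    exact: vars_belowW (sm j).
  have E v : (fun j => teval (fun j => if j == m then v else e j) (s' j)) =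
             (fun j => if j == i then v else teval e (s j)).
    apply/funext => j; rewrite /s'; case: ifP => _ /=; first by rewrite eqxx.
    by apply: (sm j) => k km; rewrite ltn_eqF.
  by split => -[v hv]; exists v; move: hv; rewrite (ih m.+1 s' _ sm') E.
Qed.

(** Definability of conditions on environments: variables are addressed by number and quantifiers
    overwrite one of them, so formulas can be assembled without row vectors. *)
Definition Def (P : (nat -> R) -> Prop) := exists phi, forall e, P e <-> holds e phi.

Definition DTerm (f : (nat -> R) -> R) := exists t, forall e, teval e t = f e.

Lemma Def_ext (P Q : (nat -> R) -> Prop) : (forall e, P e <-> Q e) -> Def P -> Def Q.
Proof. by move=> PQ [phi h]; exists phi => e; rewrite -PQ. Qed.

Lemma Def_not (P : (nat -> R) -> Prop) : Def P -> Def (fun e => ~ P e).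
Proof. by move=> [phi h]; exists (FNot phi) => e /=; rewrite h. Qed.

Lemma Def_and (P Q : (nat -> R) -> Prop) : Def P -> Def Q -> Def (fun e => P e /\ Q e).
Proof. by move=> [phi h] [psi h']; exists (FAnd phi psi) => e /=; rewrite h h'. Qed.

Lemma Def_or (P Q : (nat -> R) -> Prop) : Def P -> Def Q -> Def (fun e => P e \/ Q e).
Proof.
move=> /Def_not dP /Def_not dQ; apply: Def_ext (Def_not (Def_and dP dQ)) => e.
rewrite not_andE !notE; tauto.
Qed.

Lemma Def_ex i (P : (nat -> R) -> Prop) : Def P ->
  Def (fun e => exists v, P (fun j => if j == i then v else e j)).
Proof.
by move=> [phi h]; exists (FExists i phi) => e /=; split => -[v hv]; exists v; apply/h.
Qed.

Lemma Def_eq (f g : (nat -> R) -> R) : DTerm f -> DTerm g -> Def (fun e => f e = g e).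
Proof. by move=> [t ht] [u hu]; exists (FEq t u) => e /=; rewrite ht hu. Qed.

Lemma Def_true : Def (fun=> True).
Proof.
by apply: Def_ext (Def_eq (f := fun=> 0) (g := fun=> 0) _ _) => //; exists (TPar M 0).
Qed.

Lemma Def_false : Def (fun=> False).
Proof. by apply: Def_ext (Def_not Def_true) => e; tauto. Qed.

Lemma DTerm_var i : DTerm (fun e => e i). Proof. by exists (TVar M i). Qed.

Lemma DTerm_cst c : DTerm (fun=> c). Proof. by exists (TPar M c). Qed.

Lemma DTerm_app n (f : 'rV[R]_n -> R) (g : 'I_n -> (nat -> R) -> R) :
  prim_fun M f -> (forall j, DTerm (g j)) -> DTerm (fun e => f (\row_j g j e)).
Proof.
move=> pf /choice[ts tsP]; exists (TApp pf ts) => e /=.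
by congr f; apply/rowP => j; rewrite !mxE.
Qed.

Lemma Def_rel n (P : set 'rV[R]_n) (g : 'I_n -> (nat -> R) -> R) :
  prim_rel M P -> (forall j, DTerm (g j)) -> Def (fun e => P (\row_j g j e)).
Proof.
move=> pP /choice[ts tsP]; exists (FRel pP ts) => e /=.
by rewrite (_ : (\row_j _) = \row_j teval e (ts j))//; apply/rowP => j; rewrite !mxE.
Qed.

(** This is what substitution is for: membership in a definable set may be asserted of any tuple of
    terms. *)
Lemma Def_definable n (A : set 'rV[R]_n) (g : 'I_n -> (nat -> R) -> R) :
  definable M A -> (forall j, DTerm (g j)) -> Def (fun e => A (\row_j g j e)).
Proof.
move=> [phi hphi] /choice[ts tsP].
have [m tm] := vars_below_bound (fun j => vars_below_exists (ts j)).
(* Indices from [n] on receive the constant 0, in agreement with [env_of]. *)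
pose s i := if insub i is Some j then ts j else TPar M 0.
have sm i : vars_below m (s i) by rewrite /s; case: insubP.
exists (subst_formula m s phi) => e; rewrite holds_subst// hphi.
rewrite (_ : env_of _ = fun j => teval e (s j))//; apply/funext => i.
by rewrite /env_of /s; case: insubP => //= j _ _; rewrite mxE.
Qed.

Lemma definable_Def n (A : set 'rV[R]_n) (P : (nat -> R) -> Prop) :
  Def P -> (forall x, A x <-> P (env_of x)) -> definable M A.
Proof. by move=> [phi h] AP; exists phi => x; rewrite AP h. Qed.

Lemma env_of_ord n (x : 'rV[R]_n) (i : 'I_n) : env_of x i = x 0 i.
Proof. by rewrite /env_of valK. Qed.

(** An arbitrary expansion, because part 2 uses the definability of zeta inside the o-minimal
    structure. *)
Hypothesis hM : expansion_of (R_an_star_exp R) M.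

Definition ord2_fun (T : Type) (a b : T) (j : 'I_2) := if j == 0 then a else b.

Lemma DTerm_app2 (f : 'rV[R]_2 -> R) (a b : (nat -> R) -> R) : prim_fun M f ->
  DTerm a -> DTerm b -> DTerm (fun e => f (\row_j ord2_fun (a e) (b e) j)).
Proof.
move=> pf da db.
have [|t ht] := DTerm_app pf (g := ord2_fun a b).
  by move=> j; rewrite /ord2_fun; case: ifP.
exists t => e; rewrite ht; congr f; apply/rowP => j.
by rewrite !mxE /ord2_fun; case: ifP.
Qed.

Let field_prim n (f : 'rV[R]_n -> R) : field_fun f -> prim_fun M f.
Proof. by move=> ff; apply: (proj1 hM); left; left. Qed.

Lemma an_star_prim m n (f : 'rV[R]_(m + n) -> R) : an_star f -> prim_fun M f.
Proof. by move=> ff; apply: (proj1 hM); left; right; exact: AnStar. Qed.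

Lemma DTerm_add f g : DTerm f -> DTerm g -> DTerm (fun e => f e + g e).
Proof.
move=> df dg; have [t ht] := DTerm_app2 (field_prim (FieldAdd R)) df dg.
by exists t => e; rewrite ht !mxE.
Qed.

Lemma DTerm_mul f g : DTerm f -> DTerm g -> DTerm (fun e => f e * g e).
Proof.
move=> df dg; have [t ht] := DTerm_app2 (field_prim (FieldMul R)) df dg.
by exists t => e; rewrite ht !mxE.
Qed.

Lemma DTerm_opp f : DTerm f -> DTerm (fun e => - f e).
Proof.
move=> df; have [t ht] := DTerm_app (field_prim (FieldOpp R)) (fun=> df).
by exists t => e; rewrite ht !mxE.
Qed.

Lemma DTerm_sub f g : DTerm f -> DTerm g -> DTerm (fun e => f e - g e).
Proof. by move=> df dg; apply: DTerm_add => //; exact: DTerm_opp. Qed.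

Lemma DTerm_exp f : DTerm f -> DTerm (fun e => expR (f e)).
Proof.
move=> df; have pf : prim_fun M (fun x : 'rV[R]_1 => expR (x 0 0)).
  by apply: (proj1 hM); right; exact: ExpFun.
have [t ht] := DTerm_app pf (fun=> df).
by exists t => e; rewrite ht !mxE.
Qed.

Lemma Def_lt f g : DTerm f -> DTerm g -> Def (fun e => f e < g e).
Proof.
move=> df dg; have pP : prim_rel M [set x : 'rV[R]_2 | x 0 0 < x 0 1].
  by apply: (proj2 hM); exact: OrderLt.
apply: Def_ext (Def_rel (g := ord2_fun f g) pP _) => [e|j].
  by rewrite /= !mxE.
by rewrite /ord2_fun; case: ifP.
Qed.

Lemma Def_le f g : DTerm f -> DTerm g -> Def (fun e => f e <= g e).
Proof.
move=> df dg; apply: Def_ext (Def_not (Def_lt dg df)) => e.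
by rewrite leNgt; split => [/negP|/negP].
Qed.

End definability_calculus.

(** * Functions of the structure *)

Section an_star_functions.
Variable R : realType.

Section extension.
Variables (I T : choiceType) (e : I -> T) (b : I -> R).

Definition extend_by0 (t : T) : R :=
  if pselect (exists i, e i = t) is left h then b (projT1 (cid h)) else 0.

Lemma extend_by0E i : injective e -> extend_by0 (e i) = b i.
Proof.
move=> ei; rewrite /extend_by0; case: pselect => [h|]; last by case; exists i.
by case: cid => j /= /ei ->.
Qed.

Lemma extend_by0_out t : ~ range e t -> extend_by0 t = 0.
Proof. by move=> et; rewrite /extend_by0; case: pselect => // -[i it]; case: et; exists i. Qed.

End extension.

(** Lets a series be given by its own index set, with exponents [ex i], and extended by 0 to all
    exponents. In each generalized variable the exponents lie on an increasing sequence, so a least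
    index yields a least exponent and the support is well ordered. *)
Lemma an_star_of_family m n (I : choiceType) (ex : I -> 'rV[R]_m * 'rV[nat]_n)
    (b : I -> R) (t : 'rV[R]_m) (u : 'rV[R]_n) :
  injective ex ->
  (forall j, exists s : nat -> R,
    [/\ forall k, 0 <= s k, {mono s : k l / (k <= l)%N >-> k <= l} &
        forall i, exists k, (ex i).1 0 j = s k]) ->
  (forall i, 1 < t 0 i) -> (forall j, 1 < u 0 j) ->
  abs_summable (fun i => b i * mixed_monomial t u (ex i)) ->
  exists2 f : 'rV[R]_(m + n) -> R, an_star f &
    forall (x : 'rV[R]_m) (y : 'rV[R]_n),
      (forall i, 0 <= x 0 i <= 1) -> (forall j, -1 <= y 0 j <= 1) ->
      f (row_mx x y) = family_sum (fun i => b i * mixed_monomial x y (ex i)).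
Proof.
move=> ei wo t1 u1 sb; pose a := extend_by0 ex b.
have a0 (x : 'rV[R]_m) (y : 'rV[R]_n) p : ~ range ex p -> a p * mixed_monomial x y p = 0.
  by move=> pe; rewrite /a extend_by0_out// mul0r.
have ae (x : 'rV[R]_m) (y : 'rV[R]_n) :
    (fun p => a p * mixed_monomial x y p) \o ex = fun i => b i * mixed_monomial x y (ex i).
  by apply/funext => i /=; rewrite /a extend_by0E.
pose f (v : 'rV[R]_(m + n)) :=
  if [forall i, 0 <= lsubmx v 0 i <= 1] && [forall j, -1 <= rsubmx v 0 j <= 1]
  then family_sum (fun p => a p * mixed_monomial (lsubmx v) (rsubmx v) p) else 0.
exists f; last first.
  move=> x y /forallP x01 /forallP y01.
  by rewrite /f row_mxKl row_mxKr x01 y01 /= (family_sum_inj ei (@a0 _ _)) ae.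
exists a; split.
- exists (fun j => [set c | exists2 p, (exists i, ex i = p) & c = p.1 0 j]).
  split => [j|p ap j]; last first.
    exists p => //; apply: contrapT => h; move: ap; rewrite /a extend_by0_out ?eqxx//.
    by move=> [i _ ip]; apply: h; exists i.
  have [s [s0 smono sP]] := wo j; split.
    by move=> _ /= [p [i <-] ->]; have [k ->] := sP i.
  apply: wochoice.antisymmetric_wo_chain => [x y _ _|A As [x xA]].
    by move=> /andP[xy yx]; apply/eqP; rewrite eq_le xy yx.
  have sA y : y \in A -> exists k, y = s k.
    by move=> yA; have := As y yA; rewrite inE => -[p [i <-] ->]; exact: sP.
  have ex_k : exists k, s k \in A by have [k xk] := sA x xA; exists k; rewrite -xk.
  case: (ex_minnP ex_k) => k kA kmin; exists (s k); split => // y yA.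
  have [l yl] := sA y yA; rewrite yl smono; apply: kmin; by rewrite -yl.
- exists t, u; split => //; rewrite /converges_at /summable.
  rewrite (eq_esum (b := fun p => (`|a p * mixed_monomial t u p|)%:E)); last first.
    by move=> p _ /=; rewrite !normrM normr_id.
  have E := abs_summable_inj ei (@a0 t u); rewrite ae in E.
  by rewrite -/(abs_summable (fun p => a p * mixed_monomial t u p)) E.
- by move=> x y; rewrite /f row_mxKl row_mxKr.
Qed.

End an_star_functions.

(** * Primitives representing analytic functions and the Dirichlet series *)

Section an_star_pieces.
Variable R : realType.
Implicit Types (z w : R[i]) (x y : R).

Lemma cvgR_unique (u : nat -> R) (l l' : R) :
  u @ \oo --> l -> u @ \oo --> l' -> l = l'.
Proof.
by move=> ul ul'; rewrite -(cvg_lim (@Rhausdorff R) ul) -(cvg_lim (@Rhausdorff R) ul').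
Qed.

Lemma Re_seriesZ z (F : nat -> R[i]) (s : R[i]) : series F @ \oo --> (s : R[i]^o) ->
  series (fun n => complex.Re (z * F n)) @ \oo --> complex.Re (z * s).
Proof. by move=> /(seriesCZ z)/seriesC_P[]. Qed.

Arguments Re_seriesZ z {F s} _.

Lemma family_sum_iterated (f : nat -> nat -> R) (r : nat -> R) (s : R) :
  abs_summable (fun p => f p.1 p.2) ->
  (forall i, series (f i) @ \oo --> r i) -> series r @ \oo --> s ->
  family_sum (fun p => f p.1 p.2) = s.
Proof.
move=> /fubini_series[r' [r'P r's]] rP rs.
have er : r = r' by apply/funext => i; exact: cvgR_unique (rP i) (r'P i).
by rewrite er in rs; exact: cvgR_unique r's rs.
Qed.

Lemma Re_analytic_an_star (f : R[i] -> R[i]) z0 : analytic_at f z0 ->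
  exists (rho : R) (F : 'rV[R]_(0 + 2) -> R), [/\ 0 < rho, an_star F &
    forall y1 y2, -1 <= y1 <= 1 -> -1 <= y2 <= 1 ->
      F (\row_j ord2_fun y1 y2 j) = complex.Re (f (z0 + (rho * y1) +i* (rho * y2)))].
Proof.
move=> /analytic_atP[r [c [r0 cf]]].
(* At the polyradius [(2, 2)] the expansion is dominated by the power series at [4 * rho = r / 2],
   inside the disc of convergence. *)
pose rho := r / 8; have rho0 : 0 < rho by rewrite /rho; lra.
pose G y1 y2 k l : R := complex.Re (c k * 'i ^+ l) * 'C(k, l)%:R * rho ^+ k *
  (y1 ^+ (k - l) * y2 ^+ l).
have nci k l : `|complex.Re (c k * 'i ^+ l)| <= nrm (c k).
  by apply: le_trans (normRe_le _) _; rewrite nrmM nrmX nrm_i expr1n mulr1.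
have [||K KP] := @power_series_abs_bounded _ c r (rho * 4).
- move=> w wr; exists (f (z0 + w)).
  by have := cf (z0 + w); rewrite [_ - z0]addrC addKr; apply.
- by rewrite /rho; lra.
have sG2 : abs_summable (fun p : nat * nat => G 2 2 p.1 p.2).
  apply: (@abs_summable2 _ (G 2 2) _ K) KP => k n.
  apply: le_trans (finite_series_le (N := k.+1) _ _ _) _ => // [l kl|].
    by rewrite /G bin_small// mulr0 !mul0r normr0.
  rewrite (_ : 4 = 2 + 2); last by ring.
  rewrite [(rho * _) ^+ k]exprMn exprDn !mulr_sumr.
  apply: ler_sum => l _; rewrite /G !normrM !normrX !normr_nat (gtr0_norm rho0).
  rewrite -[X in _ <= _ * (_ * X)]mulr_natr.
  rewrite -!mulrA ler_pM ?mulr_ge0 ?exprn_ge0 ?(ltW rho0)//.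
  by rewrite le_eqVlt; apply/orP; left; apply/eqP; ring.
have sG y1 y2 : `|y1| <= 1 -> `|y2| <= 1 ->
    abs_summable (fun p : nat * nat => G y1 y2 p.1 p.2).
  move=> h1 h2; apply: le_abs_summable sG2 => -[k l]/=.
  rewrite /G !normrM ler_wpM2l ?mulr_ge0// !normrX normr_nat.
  by apply: ler_pM; rewrite ?exprn_ge0// lerXn2r ?nnegrE//; lra.
(* A term with [l <= k] has exponents [(k - l, l)]. Indexing by the exponents makes the monomials
   distinct, and the terms outside the range of [e] vanish with their binomial coefficient. *)
pose e (p : nat * nat) := (p.1 + p.2, p.2)%N.
have ei : injective e by move=> [a b] [a' b'] [/= + hb]; rewrite hb => /addIn ->.
have Gout y1 y2 (p : nat * nat) : ~ range e p -> G y1 y2 p.1 p.2 = 0.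
  case: p => k l he; rewrite /G bin_small ?mulr0 ?mul0r//= ltnNge.
  by apply/negP => lk; apply: he; exists (k - l, l)%N => //; rewrite /e/= subnK.
pose ex (p : nat * nat) : 'rV[R]_0 * 'rV[nat]_2 := (0, \row_i ord2_fun p.1 p.2 i).
pose b (p : nat * nat) : R :=
  complex.Re (c (p.1 + p.2)%N * 'i ^+ p.2) * 'C(p.1 + p.2, p.2)%:R * rho ^+ (p.1 + p.2).
have bG (x : 'rV[R]_0) y1 y2 :
    (fun p => b p * mixed_monomial x (\row_j ord2_fun y1 y2 j) (ex p)) =
    (fun p => G y1 y2 p.1 p.2) \o e.
  apply/funext => -[j l]; rewrite /= /b /G /mixed_monomial big_ord0 mul1r.
  by rewrite !big_ord_recl big_ord0 !mxE /ord2_fun/= mulr1 addnK.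
have [|||||F anF FP] := @an_star_of_family _ 0 2 _ ex b 0 (\row_j ord2_fun 2 2 j).
- move=> [j l] [j' l'] /(congr1 snd)/rowP h.
  by have := h 0; have := h 1; rewrite !mxE /ord2_fun/= => -> ->.
- by case.
- by case.
- by move=> j; rewrite mxE /ord2_fun; case: ifP => _; lra.
- by rewrite bG -(abs_summable_inj ei (@Gout 2 2)).
exists rho, F; split => // y1 y2 h1 h2.
rewrite (_ : (\row_j ord2_fun y1 y2 j) = row_mx (0 : 'rV_0) (\row_j ord2_fun y1 y2 j)); last first.
  apply/rowP => j; rewrite !mxE; case: splitP => [[]//|k jk]; rewrite mxE.
  by congr ord2_fun; exact: val_inj.
rewrite FP => [||j]; last 2 first.
- by case.
- by rewrite mxE /ord2_fun; case: ifP.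
rewrite bG -(family_sum_inj ei (@Gout y1 y2)).
pose v : R[i] := (rho * y1) +i* (rho * y2).
have vE : v = (rho * y1)%:C + 'i * (rho * y2)%:C by rewrite /v [LHS]complexE.
apply: (@family_sum_iterated _ (fun k => complex.Re (1 * (c k * v ^+ k)))).
- by apply: sG; rewrite ler_norml.
- move=> k; have -> : complex.Re (1 * (c k * v ^+ k)) = \sum_(l < k.+1) G y1 y2 k l.
    rewrite mul1r vE exprDn mulr_sumr Re_sum; apply: eq_bigr => l _.
    have lk : (l <= k)%N by rewrite -ltnS.
    rewrite mulrnAr exprMn -!rmorphXn/=.
    rewrite (_ : c k * _ = c k * 'i ^+ l * ((rho * y1) ^+ (k - l) * (rho * y2) ^+ l)%:C); last first.
      by rewrite rmorphM/=; move: (_%:C) (_%:C) ('i ^+ l) => x1 x2 x3; ring.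
    have rk : rho ^+ k = rho ^+ (k - l) * rho ^+ l by rewrite -exprD subnK.
    rewrite -mulrnAr -rmorphMn/= ReMr /G rk -mulr_natr !(exprMn _ rho).
    by move: (rho ^+ _) (rho ^+ _) => r1 r2; ring.
  have h l : (k.+1 <= l)%N -> (G y1 y2 k l)%:C = 0 :> R[i].
    by move=> kl; rewrite /G bin_small// mulr0 !mul0r.
  have := seriesC_fin h; rewrite -rmorph_sum => /seriesC_P[]/=.
  by rewrite /= -[X in _ --> X]/(complex.Re (\sum_(l < k.+1) G y1 y2 k l)%:C).
- have nv : nrm v < r.
    apply: le_lt_trans (nrm_le _) _ => /=; rewrite !(normrM rho) (gtr0_norm rho0).
    have a1 : `|y1| <= 1 by rewrite ler_norml.
    have a2 : `|y2| <= 1 by rewrite ler_norml.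
    have := ler_wpM2l (ltW rho0) a1; have := ler_wpM2l (ltW rho0) a2.
    by rewrite /rho; lra.
  have := cf (z0 + v); rewrite [_ - z0]addrC addKr => /(_ nv)/(Re_seriesZ 1).
  by rewrite mul1r.
Qed.

(** The factor [omega] treats real and imaginary parts at once: [1] and [- 'i] are the values used.
    The constant [exp (- T * L n)] in [cf] combines with [X ^ (L n)] to [exp (- x * L n)]. *)
Lemma dirichlet_an_star (omega : R[i]) (T s : R) : nrm omega <= 1 -> 0 < s ->
  3 + 2 * s <= T ->
  exists2 F : 'rV[R]_(1 + 1) -> R, an_star F &
    forall x y (Z : R[i]), T <= x -> -s <= y <= s ->
      series (fun n => expC (- (x +i* y) * (ln n.+1%:R)%:C)) @ \oo --> (Z : R[i]^o) ->
      F (\row_j ord2_fun (expR (T - x)) (y / s) j) = complex.Re (omega * Z).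
Proof.
move=> om1 s0 sT; pose L n : R := ln n.+1%:R.
have L0 n : 0 <= L n by rewrite /L ln_ge0// ler1n.
pose cf n k : R := expR (- T * L n) * (complex.Re (omega * (- 'i) ^+ k) * (L n * s) ^+ k / k`!%:R).
pose G X Y n k := cf n k * (X `^ L n * Y ^+ k).
have sG2 : abs_summable (fun p : nat * nat => G 2 2 p.1 p.2).
  (* With [m = n + 1], row [n] is at most [m ^ (ln 2 - T + 2 * s) <= m ^ (- 2)], and
     [1 / m ^ 2 <= 2 * (1 / m - 1 / (m + 1))] telescopes. *)
  apply: (@abs_summable2 _ (G 2 2) (fun n => 2 * (n.+1%:R^-1 - n.+2%:R^-1)) 2) => [n N|N]; last first.
    have -> : series (fun n => 2 * (n.+1%:R^-1 - n.+2%:R^-1)) N = 2 * (1 - N.+1%:R^-1) :> R.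
      rewrite /series/=; elim: N => [|N ih]; first by rewrite big_nil invr1 subrr mulr0.
      by rewrite big_nat_recr//= ih; ring.
    have : 0 < N.+1%:R^-1 :> R by rewrite invr_gt0.
    by move: (_^-1) => q q0; lra.
  apply: (@le_trans _ _ (expR (L n * (ln 2 - T)) * series (fun k => (2 * (L n * s)) ^+ k / k`!%:R) N)).
    rewrite /series/= mulr_sumr; apply: ler_sum => k _.
    rewrite /G /cf /powR (_ : (2 == 0) = false) ?pnatr_eq0// !normrM !normrX [`|L n * s|]normrM normr_nat.
    rewrite !(ger0_norm (expR_ge0 _)) (ger0_norm (L0 n)) (gtr0_norm s0) normfV normr_nat.
    have h : `|complex.Re (omega * (- 'i) ^+ k)| <= 1.
      apply: le_trans (normRe_le _) _.
      by rewrite nrmM nrmX nrmN nrm_i expr1n mulr1.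
    rewrite mulrBr expRD [L n * T]mulrC -mulNr !(exprMn _ 2).
    rewrite (_ : _ * _ * _ = `|complex.Re (omega * (- 'i) ^+ k)| *
      (expR (L n * ln 2) * expR (- T * L n) * (2 ^+ k * (L n * s) ^+ k / k`!%:R))); last by ring.
    by rewrite ler_piMl// !mulr_ge0 ?expR_ge0 ?exprn_ge0 ?mulr_ge0 ?invr_ge0 ?(ltW s0).
  apply: (@le_trans _ _ (expR (L n * (ln 2 - T)) * expR (2 * (L n * s)))).
    by rewrite ler_wpM2l ?expR_ge0// series_exp_le// !mulr_ge0 ?(ltW s0).
  rewrite -expRD.
  have ln2 : ln 2 <= 1 :> R.
    by have := @le_ln1Dx R 1; rewrite (_ : 1 + 1 = 2)//; apply; lra.
  apply: (@le_trans _ _ (expR (- L n + - L n))).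
    rewrite ler_expR (_ : _ + 2 * _ = L n * (ln 2 - T + 2 * s)); last by ring.
    by have := ler_wpM2l (L0 n) (_ : ln 2 - T + 2 * s <= -2); lra.
  rewrite expRD !expRN /L lnK ?posrE ?ltr0n//.
  rewrite (_ : n.+1%:R^-1 - _ = n.+1%:R^-1 * n.+2%:R^-1 :> R); last first.
    have : 0 < n.+1%:R :> R by rewrite ltr0n.
    by rewrite [n.+2%:R]mulrS; move: n.+1%:R => q q0; field; rewrite !gt_eqF//; lra.
  rewrite mulrCA ler_wpM2l ?invr_ge0//.
  rewrite -[leLHS]mul1r ler_pdivrMr ?ltr0n// mulrAC ler_pdivlMr ?ltr0n// mul1r.
  by rewrite -natrM ler_nat; lia.
have sG X Y : 0 <= X <= 1 -> `|Y| <= 1 -> abs_summable (fun p : nat * nat => G X Y p.1 p.2).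
  move=> /andP[X0 X1] Y1; apply: le_abs_summable sG2 => -[n k]/=.
  rewrite /G !normrM ler_wpM2l// !normrX normr_nat !(ger0_norm (powR_ge0 _ _)).
  apply: ler_pM; rewrite ?powR_ge0 ?exprn_ge0//.
    by apply: ge0_ler_powR; rewrite ?nnegrE//; lra.
  by rewrite lerXn2r ?nnegrE//; lra.
pose ex (p : nat * nat) : 'rV[R]_1 * 'rV[nat]_1 := (const_mx (L p.1), const_mx p.2).
pose b (p : nat * nat) := cf p.1 p.2.
have bG X Y : (fun p => b p * mixed_monomial (const_mx X) (const_mx Y) (ex p)) =
    (fun p => G X Y p.1 p.2).
  by apply/funext => p; rewrite /mixed_monomial !big_ord1 !mxE.
have Lmono : {mono L : k l / (k <= l)%N >-> k <= l}.
  by move=> k l; rewrite /L ler_ln ?posrE ?ltr0n// ler_nat ltnS.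
have Linj : injective L by move=> k l kl; apply/eqP; rewrite eqn_leq -!Lmono kl lexx.
have [|||||F anF FP] := @an_star_of_family _ 1 1 _ ex b (const_mx 2) (const_mx 2).
- move=> [n k] [n' k'] /= [/rowP/(_ 0) + /rowP/(_ 0)].
  by rewrite !mxE => /Linj -> ->.
- move=> j; exists L; split => // p; exists p.1; by rewrite mxE.
- by move=> j; rewrite mxE; lra.
- by move=> j; rewrite mxE; lra.
- by rewrite bG.
exists F => // x y Z Tx /andP[y1 y2] hZ.
pose X := expR (T - x); pose Y := y / s.
have X01 : 0 <= X <= 1 by rewrite expR_ge0 -expR0 ler_expR; lra.
have Y1 : -1 <= Y <= 1 by rewrite /Y ler_pdivlMr// ler_pdivrMr//; lra.
have -> : (\row_j ord2_fun (expR (T - x)) (y / s) j) =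
    row_mx (const_mx X) (const_mx Y) :> 'rV[R]_(1 + 1).
  apply/rowP => j; rewrite !mxE; case: splitP => k; rewrite mxE (ord1 k) /ord2_fun => jk.
    by rewrite (_ : j == 0)//; apply/eqP/val_inj.
  by rewrite (_ : (j == 0) = false)//; apply/negP => /eqP j0; move: jk; rewrite j0.
rewrite FP => [|j|j]; [|by rewrite mxE|by rewrite mxE].
rewrite bG; apply: (@family_sum_iterated (G X Y)
  (fun n => complex.Re (omega * expC (- (x +i* y) * (ln n.+1%:R)%:C)))).
- by apply: sG => //; rewrite ler_norml.
- move=> n.
  have -> : - (x +i* y) * (ln n.+1%:R)%:C = (- (x * L n))%:C + - 'i * (L n * y)%:C.
    have -> : x +i* y = x%:C + 'i * y%:C by rewrite [LHS]complexE.
    by rewrite /L rmorphN !rmorphM/=; ring.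
  rewrite expCD expC_real mulrA.
  have := Re_seriesZ (omega * (expR (- (x * L n)))%:C) (series_expC (- 'i * (L n * y)%:C)).
  rewrite (_ : (fun k => _) = G X Y n)//; apply/funext => k.
  rewrite exprMn -rmorphXn/= -mulrA [_ * (_ * (_ * _))]mulrA.
  rewrite (_ : _ * _ = omega * (- 'i) ^+ k * (expR (- (x * L n)) * ((L n * y) ^+ k / k`!%:R))%:C); last first.
    rewrite !rmorphM/=; move: ((- 'i) ^+ k) (_%:C) (_%:C) (_%:C) => x1 x2 x3 x4; ring.
  rewrite ReMr /G /cf /powR gt_eqF ?expR_gt0// /X expRK.
  have -> : expR (- (x * L n)) = expR (- T * L n) * expR (L n * (T - x)).
    by rewrite -expRD; congr expR; ring.
  have -> : (L n * y) ^+ k = (L n * s) ^+ k * Y ^+ k.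
    by rewrite -exprMn /Y; congr (_ ^+ _); field; rewrite gt_eqF.
  by ring.
- exact: (Re_seriesZ omega hZ).
Qed.

End an_star_pieces.

(* [compact_cover] on [R * R] needs the missing [ptopologicalType] instance. *)
HB.saturate prod.

(** * Definability on vertical half-strips *)

Section zeta_definable.
Variables (R : realType) (M : structure R).
Hypothesis hM : expansion_of (R_an_star_exp R) M.
Implicit Types (z : R[i]) (e : nat -> R) (x y t s : R).

Let env_z e : R[i] := e 0%N +i* e 1%N.

Lemma Def_exists_seq (T : eqType) (l : seq T) (P : T -> (nat -> R) -> Prop) :
  (forall p, Def M (P p)) -> Def M (fun e => exists2 p, p \in l & P p e).
Proof.
move=> dP; elim: l => [|a l ih].
  by apply: Def_ext (Def_false M) => e; split => // -[].
apply: Def_ext (Def_or (dP a) ih) => e; split => [[Pa|[x xl Px]]|[x]].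
- by exists a; rewrite ?mem_head.
- by exists x; rewrite // inE xl orbT.
- by rewrite inE => /predU1P[->|xl Px]; [left|right; exists x].
Qed.

Lemma Def_neq1 : Def M (fun e => env_z e != 1).
Proof.
have d := Def_not (Def_and (Def_eq (DTerm_var M 0) (DTerm_cst M 1))
                           (Def_eq (DTerm_var M 1) (DTerm_cst M 0))).
apply: Def_ext d => e; split => [h|/eqP h [h0 h1]].
  by apply/eqP => -[h0 h1]; apply: h.
by apply: h; rewrite /env_z h0 h1.
Qed.

Lemma Re_analytic_Def (f : R[i] -> R[i]) z0 : analytic_at f z0 ->
  exists2 rho : R, 0 < rho & exists2 g : (nat -> R) -> R, DTerm M g &
    forall e, `|e 0%N - complex.Re z0| <= rho -> `|e 1%N - complex.Im z0| <= rho ->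
      g e = complex.Re (f (env_z e)).
Proof.
move=> /Re_analytic_an_star[rho [F [rho0 anF FP]]]; exists rho => //.
pose c i (x0 : R) e : R := (e i - x0) * rho^-1.
have dc i x0 : DTerm M (c i x0).
  by apply: (DTerm_mul hM); [apply: (DTerm_sub hM); [exact: DTerm_var|]|]; exact: DTerm_cst.
exists (fun e => F (\row_j ord2_fun (c 0 (complex.Re z0) e) (c 1 (complex.Im z0) e) j))%N.
  exact: (@DTerm_app2 _ _ F _ _ (an_star_prim hM anF)).
move=> e h0 h1; rewrite FP; last 2 first.
- by rewrite -ler_norml /c normrM normfV (gtr0_norm rho0) ler_pdivrMr// mul1r.
- by rewrite -ler_norml /c normrM normfV (gtr0_norm rho0) ler_pdivrMr// mul1r.
congr (complex.Re (f _)); rewrite /c /env_z; apply/eqP.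
by rewrite eq_complex ReD ImD/=; apply/andP; split; apply/eqP; field; rewrite gt_eqF.
Qed.

(* Multiplying [e 2 = Re (h z / (z - 1))] by [`|z - 1| ^+ 2] gives a formula in
   the real and imaginary parts of the entire function [h]. *)
Lemma Re_meromorphic_local (h phi : R[i] -> R[i]) z0 : (forall z, analytic_at h z) ->
  (forall z, z != 1 -> h z = (z - 1) * phi z) ->
  exists2 rho : R, 0 < rho & exists2 Q : (nat -> R) -> Prop, Def M Q &
    forall e, `|e 0%N - complex.Re z0| <= rho -> `|e 1%N - complex.Im z0| <= rho ->
      env_z e != 1 -> (Q e <-> e 2%N = complex.Re (phi (env_z e))).
Proof.
move=> han hphi.
have [r1 r10 [g1 dg1 g1P]] := Re_analytic_Def (han z0).
have [r2 r20 [g2 dg2 g2P]] := Re_analytic_Def (analytic_atZ (- 'i) (han z0)).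
exists (Num.min r1 r2); first by rewrite lt_min r10.
pose X e : R := e 0%N - 1; pose Y e : R := e 1%N.
have dX : DTerm M X by apply: (DTerm_sub hM); [exact: DTerm_var|exact: DTerm_cst].
have dY : DTerm M Y by exact: DTerm_var.
exists (fun e => e 2%N * (X e * X e + Y e * Y e) = g1 e * X e + g2 e * Y e).
  apply: Def_eq; first apply: (DTerm_mul hM); first exact: DTerm_var.
    by apply: (DTerm_add hM); exact: (DTerm_mul hM).
  by apply: (DTerm_add hM); exact: (DTerm_mul hM).
move=> e; rewrite !le_min => /andP[h1 h2] /andP[h3 h4] z1.
rewrite (g1P e h1 h3) (g2P e h2 h4) (hphi _ z1).
set w := phi _; have zE : env_z e - 1 = X e +i* Y e.
  by rewrite /env_z /X /Y; apply/eqP; rewrite eq_complex ReB ImB/= subr0 !eqxx.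
have nz : X e * X e + Y e * Y e != 0.
  apply: contra z1; rewrite -!expr2 paddr_eq0 ?sqr_ge0// !sqrf_eq0 => /andP[/eqP X0 /eqP Y0].
  by rewrite -subr_eq0 zE X0 Y0 eq_complex/= !eqxx.
have -> : complex.Re ((env_z e - 1) * w) * X e + complex.Re (- 'i * ((env_z e - 1) * w)) * Y e =
    complex.Re w * (X e * X e + Y e * Y e).
  by rewrite zE; case: (w) => a b /=; ring.
by split => [/(mulIf nz)|->].
Qed.

(** Finitely many of the local squares cover the rectangle. The disjunction of their formulas needs
    no compatibility on overlaps, since each one pins [e 2] to the same value. *)
Lemma Re_meromorphic_rectangle (h phi : R[i] -> R[i]) t T s :
  (forall z, analytic_at h z) -> (forall z, z != 1 -> h z = (z - 1) * phi z) ->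
  exists2 Q : (nat -> R) -> Prop, Def M Q &
    forall e, t <= e 0%N <= T -> - s <= e 1%N <= s ->
      env_z e != 1 -> (Q e <-> e 2%N = complex.Re (phi (env_z e))).
Proof.
move=> han hphi.
have /choice[rho rhoP] : forall p : R * R, exists rho : R, 0 < rho /\
    exists2 Q : (nat -> R) -> Prop, Def M Q &
    forall e, `|e 0%N - p.1| <= rho -> `|e 1%N - p.2| <= rho ->
      env_z e != 1 -> (Q e <-> e 2%N = complex.Re (phi (env_z e))).
  move=> p; have [rho rho0 h'] := Re_meromorphic_local (p.1 +i* p.2) han hphi.
  by exists rho.
have /choice[Q QP] : forall p : R * R, exists Q : (nat -> R) -> Prop, Def M Q /\
    forall e, `|e 0%N - p.1| <= rho p -> `|e 1%N - p.2| <= rho p ->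
      env_z e != 1 -> (Q e <-> e 2%N = complex.Re (phi (env_z e))).
  by move=> p; have [_ [Q dQ QP]] := rhoP p; exists Q.
have cK : compact (`[t, T]%classic `*` `[- s, s]%classic : set (R * R)).
  by apply: compact_setX; exact: segment_compact.
move: cK; rewrite compact_cover => /(_ _ setT (fun p => (ball p (rho p))°)).
case=> [p _|q _|D _ KD]; first exact: open_interior.
  by exists q => //; apply: nbhsx_ballx; exact: (rhoP q).1.
exists (fun e => exists2 p, p \in (finmap.enum_fset D : seq (R * R)) &
   ((p.1 - rho p <= e 0%N /\ e 0%N <= p.1 + rho p) /\
    (p.2 - rho p <= e 1%N /\ e 1%N <= p.2 + rho p)) /\ Q p e).
  apply: Def_exists_seq => p; apply: Def_and (QP p).1.
  by apply: Def_and; apply: Def_and; apply: (Def_le hM);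
    (exact: DTerm_var || exact: DTerm_cst).
move=> e te se z1.
have inb (a b c : R) : (a - c <= b /\ b <= a + c) <-> `|b - a| <= c.
  by rewrite ler_norml; split => [[h1 h2]|/andP[h1 h2]]; [apply/andP|]; split; lra.
split => [[p _ [[/inb h1 /inb h2] Qp]]|he].
  exact/((QP p).2 e h1 h2 z1).
have [|p pD /interior_subset[/= b1 b2]] := KD (e 0, e 1)%N.
  by split; rewrite /= in_itv.
exists p => //; have h1 : `|e 0%N - p.1| <= rho p by rewrite distrC ltW.
have h2 : `|e 1%N - p.2| <= rho p by rewrite distrC ltW.
by split; [split; apply/inb|apply/((QP p).2 e h1 h2 z1)].
Qed.

Variable zeta : R[i] -> R[i].
Hypothesis hzeta : is_riemann_zeta zeta.

(** Glues the Dirichlet expansion for [Re z > T] to the rectangle [t <= Re z <= T]. Taking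
    [omega = - 'i] turns the real part into the imaginary part of zeta. *)
Lemma Re_zeta_Def (omega : R[i]) t s : nrm omega <= 1 -> 0 < s ->
  Def M (fun e => ([set z | t < complex.Re z /\ `|complex.Im z| < s] `\ 1) (env_z e) /\
                  e 2%N = complex.Re (omega * zeta (env_z e))).
Proof.
move=> om1 s0; pose T := 3 + 2 * s.
have [h [han hz]] := zeta_mul_entire hzeta.
have [||Q dQ QP] := @Re_meromorphic_rectangle (fun z => omega * h z) (fun z => omega * zeta z) t T s.
- by move=> z; exact: analytic_atZ.
- by move=> z /hz ->; rewrite mulrCA.
have [F anF FP] := dirichlet_an_star om1 s0 (lexx T).
have dS : Def M (fun e => ((t < e 0%N /\ (- s < e 1%N /\ e 1%N < s)) /\ env_z e != 1) /\
    ((T < e 0%N /\ e 2%N = F (\row_j ord2_fun (expR (T - e 0%N)) (e 1%N * s^-1) j)) \/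
     (e 0%N <= T /\ Q e))).
  have v i := DTerm_var M i; have c a := DTerm_cst M a.
  apply: Def_and; first apply: Def_and Def_neq1.
    by apply: Def_and; [|apply: Def_and]; exact: (Def_lt hM).
  apply: Def_or; apply: Def_and => //; first exact: (Def_lt hM).
    apply: Def_eq => //; apply: (@DTerm_app2 _ _ F _ _ (an_star_prim hM anF)).
      by apply: (DTerm_exp hM); exact: (DTerm_sub hM).
    exact: (DTerm_mul hM).
  exact: (Def_le hM).
apply: Def_ext dS => e; rewrite /= ltr_norml.
have small : - s < e 1%N < s -> T < e 0%N ->
    F (\row_j ord2_fun (expR (T - e 0%N)) (e 1%N * s^-1) j) = complex.Re (omega * zeta (env_z e)).
  move=> /andP[h1 h2] h3; apply: FP; rewrite ?(ltW h1) ?(ltW h2) ?(ltW h3)//.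
  by apply: (proj2 hzeta) => /=; move: h3; rewrite /T; lra.
split.
  move=> [[[te [h1 h2]] /eqP z1]]; have h12 : - s < e 1%N < s by rewrite h1.
  case=> [[h3 ->]|[h3 /QP h4]]; first by rewrite small.
  by split => //; apply: h4; [rewrite (ltW te)|rewrite !ltW|apply/eqP].
move=> [[[te h12] /eqP z1] e2]; have /andP[h1 h2] := h12.
split => //; have [h3|h3] := ltP T (e 0%N); first by left; rewrite small.
by right; split => //; apply/QP => //; [rewrite (ltW te)|rewrite !ltW].
Qed.

Lemma definable_fun_Def (S : set R[i]) (g : R[i] -> R) :
  Def M (fun e => S (env_z e) /\ e 2%N = g (env_z e)) ->
  definable_fun M [set v : 'rV[R]_2 | S (v 0 0 +i* v 0 1)] (fun v => g (v 0 0 +i* v 0 1)).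
Proof.
move=> dP; apply: definable_Def dP _ => v.
have vE i (i3 : (i < 2 + 1)%N) : env_of v i = v 0 (Ordinal i3) by exact: (env_of_ord v (Ordinal i3)).
have e0 : env_of v 0%N = lsubmx v 0 0 by rewrite (vE 0%N isT) mxE; congr (v _ _); exact: val_inj.
have e1 : env_of v 1%N = lsubmx v 0 1 by rewrite (vE 1%N isT) mxE; congr (v _ _); exact: val_inj.
have e2 : env_of v 2%N = rsubmx v 0 0 by rewrite (vE 2%N isT) mxE; congr (v _ _); exact: val_inj.
rewrite /env_z e0 e1 e2; split => /= [[x Sx <-]|[Sv gv]].
  by rewrite row_mxKl row_mxKr mxE.
exists (lsubmx v) => //; rewrite -gv -[RHS]hsubmxK; congr row_mx.
by apply/rowP => j; rewrite mxE (ord1 j).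
Qed.

Lemma zeta_definable t s : 0 < s ->
  definable_complex M ([set z : R[i] | t < complex.Re z /\ `|complex.Im z| < s] `\ 1) zeta.
Proof.
move=> s0; split.
  apply: (@definable_fun_Def _ (fun z => complex.Re (zeta z))).
  have := @Re_zeta_Def 1 t s; rewrite nrm1 => /(_ (lexx _) s0).
  by apply: Def_ext => e; rewrite mul1r.
apply: (@definable_fun_Def _ (fun z => complex.Im (zeta z))).
have := @Re_zeta_Def (- 'i) t s; rewrite nrmN nrm_i => /(_ (lexx _) s0).
apply: Def_ext => e; have -> : complex.Re (- 'i * zeta (env_z e)) = complex.Im (zeta (env_z e)).
  by case: (zeta _) => a b /=; ring.
by [].
Qed.

End zeta_definable.

(** * Oscillation along vertical lines *)

Section vertical_gap.
Variables (R : realType) (zeta : R[i] -> R[i]).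
Hypothesis hzeta : is_riemann_zeta zeta.
Implicit Types (x tau eps : R) (n N : nat).

Let L n : R := ln n.+1%:R.

Let L_ge0 n : 0 <= L n. Proof. by rewrite /L ln_ge0// ler1n. Qed.

(** The term of the integer [n + 1] in [Re (zeta x - zeta (x + 'i * tau))]. *)
Let gap x tau n := expR (- (x * L n)) * (1 - cos (tau * L n)).

Let gap_ge0 x tau n : 0 <= gap x tau n.
Proof. by rewrite mulr_ge0 ?expR_ge0// subr_ge0 cos_le1. Qed.

Let gap_series x tau : 1 < x ->
  series (gap x tau) @ \oo --> complex.Re (zeta x%:C) - complex.Re (zeta (x +i* tau)).
Proof.
move=> x1; have term s n : complex.Re (expC (- (x +i* s) * (ln n.+1%:R)%:C)) =
    expR (- (x * L n)) * cos (s * L n).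
  have -> : - (x +i* s) * (ln n.+1%:R)%:C = (- (x * L n)) +i* (- (s * L n)).
    by apply/eqP; rewrite eq_complex ReM ImM/=; apply/andP; split; apply/eqP; rewrite /L; ring.
  by rewrite /expC/= cosN.
have S s : series (fun n => expR (- (x * L n)) * cos (s * L n)) @ \oo -->
    complex.Re (zeta (x +i* s)).
  have /seriesC_P[+ _] := proj2 hzeta (x +i* s) x1.
  by rewrite (_ : (fun n => _) = (fun n => expR (- (x * L n)) * cos (s * L n)))//;
    apply/funext => n; rewrite term.
rewrite (_ : series _ = series (fun n => expR (- (x * L n)) * cos (0 * L n)) \-
                        series (fun n => expR (- (x * L n)) * cos (tau * L n))).
  by apply: cvgB; exact: S.
apply/funext => N; rewrite /series/= -sumrB; apply: eq_bigr => n _.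
by rewrite mul0r cos0 /gap; ring.
Qed.

(** All terms of the gap are nonnegative, and that of the integer 2 alone exceeds [2 ^ (- x)],
    because [1 - cos (tau * ln 2) > 1]. *)
Lemma zeta_gap_gt x tau : 1 < x -> cos (tau * ln 2) < 0 ->
  complex.Re (zeta (x +i* tau)) < complex.Re (zeta x%:C) - expR (- (x * ln 2)).
Proof.
move=> x1 c0; have h := series_le_lim (@gap_ge0 x tau) (@gap_series x tau x1) 2.
have : expR (- (x * ln 2)) < gap x tau 1.
  by rewrite /gap /L ltr_pMr ?expR_gt0//; lra.
have := @gap_ge0 x tau 0; move: h; rewrite /series/= !big_nat_recr//= big_nil add0r.
by move: (gap x tau 0) (gap x tau 1) => a b; lra.
Qed.

(* [n ^ (- x) <= 2 ^ (- x) * (2 / n) ^ 2], so the terms with [n <= 16] and those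
   with [n > 16] each contribute at most [2 ^ (- x) / 2] to the gap. *)
Lemma zeta_gap_le x tau : 2 <= x ->
  (forall n, (n < 16)%N -> 1 - cos (tau * ln n.+1%:R) <= 1 / 16) ->
  complex.Re (zeta x%:C) - expR (- (x * ln 2)) <= complex.Re (zeta (x +i* tau)).
Proof.
move=> x2 small; have x1 : 1 < x by lra.
suff h : complex.Re (zeta x%:C) - complex.Re (zeta (x +i* tau)) <= expR (- (x * ln 2)) by lra.
have cv := @gap_series x tau x1.
rewrite -(cvg_lim (@Rhausdorff R) cv); apply: limr_le; first exact: cvgP cv.
apply: nearW => M.
pose i n : R := n%:R^-1.
(* A telescoping majorant, with [i n = 1 / n]: the first summand totals at most [1 / 2], and the
   second, starting at [n = 16], at most [8 / 16]. *)
pose g n : R := 2^-1 * (i n.+1 - i n.+2) + (if (16 <= n)%N then 8 * (i n - i n.+1) else 0).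
have i_gt0 n : 0 < i n.+1 by rewrite /i invr_gt0 ltr0n.
have gap_le n : gap x tau n <= expR (- (x * ln 2)) * g n.
  have c2 : 1 - cos (tau * L n) <= 2 by have := cos_geN1 (tau * L n); lra.
  have c0 : 0 <= 1 - cos (tau * L n) by rewrite subr_ge0 cos_le1.
  have ii : i n.+1 - i n.+2 = i n.+1 * i n.+2.
    have : 0 < n.+1%:R :> R by rewrite ltr0n.
    by rewrite /i [n.+2%:R]mulrS; move: n.+1%:R => q q0; field; rewrite !gt_eqF//; lra.
  have i12 : i n.+1 <= 2 * i n.+2.
    rewrite /i -[leLHS]mul1r ler_pdivrMr ?ltr0n// mulrAC ler_pdivlMr ?ltr0n// mul1r.
    by rewrite -natrM ler_nat; lia.
  have ii12 : i n.+1 * i n.+1 <= 2 * (i n.+1 - i n.+2).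
    by rewrite ii mulrCA ler_wpM2l// ltW.
  have Ex : (0 < n)%N -> expR (- (x * L n)) <= expR (- (x * ln 2)) * (4 * (i n.+1 * i n.+1)).
    move=> n0; have L2 : ln 2 <= L n by rewrite /L ler_ln ?posrE ?ltr0n// ler_nat.
    have -> : 4 * (i n.+1 * i n.+1) = expR (2 * (ln 2 - L n)).
      rewrite mulrBr expRD !mulr2n !mulrDl !mul1r expRN !expRD.
      by rewrite /L !lnK ?posrE ?ltr0n// /i invfM; ring.
    rewrite -expRD ler_expR.
    have := ler_wpM2r (_ : 0 <= L n - ln 2) x2; rewrite subr_ge0 => /(_ L2).
    by rewrite mulrBr; lra.
  case: n Ex ii ii12 i12 c2 c0 => [|n] Ex ii ii12 i12 c2 c0.
    rewrite /gap /L ln1 !mulr0 cos0 subrr mulr0 mulr_ge0 ?expR_ge0//.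
    by rewrite /g /= addr0 mulr_ge0 ?invr_ge0// ii mulr_ge0// ltW.
  apply: (@le_trans _ _ (expR (- (x * ln 2)) * (4 * (i n.+2 * i n.+2)) * (1 - cos (tau * L n.+1)))).
    by rewrite /gap ler_wpM2r// Ex.
  rewrite -mulrA ler_wpM2l ?expR_ge0// /g.
  have q0 : 0 <= i n.+2 * i n.+2 by rewrite mulr_ge0// ltW.
  case: ifP => n16.
    have e1 : i n.+1 - i n.+2 = i n.+1 * i n.+2.
      have : 0 < n.+1%:R :> R by rewrite ltr0n.
      by rewrite /i [n.+2%:R]mulrS; move: n.+1%:R => q q0'; field; rewrite !gt_eqF//; lra.
    have i21 : i n.+2 <= i n.+1 by rewrite -subr_ge0 e1 mulr_ge0// ltW.
    have h1 : i n.+2 * i n.+2 <= i n.+1 - i n.+2 by rewrite e1 ler_wpM2r// ltW.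
    have h2 := ler_wpM2l q0 c2.
    by move: (i n.+2 * i n.+2) (1 - _) q0 h1 h2 ii12 => a b q0 h1 h2 ii12; lra.
  have n16' : (n.+1 < 16)%N by rewrite ltnNge n16.
  have h2 := ler_wpM2l q0 (small _ n16').
  by rewrite addr0; move: (i n.+2 * i n.+2) (1 - _) q0 h2 ii12 => a b q0 h2 ii12; lra.
apply: (@le_trans _ _ (expR (- (x * ln 2)) * series g M)).
  by rewrite /series/= mulr_sumr; apply: ler_sum.
rewrite -[leRHS]mulr1 ler_wpM2l ?expR_ge0//.
have -> : series g M = 2^-1 * (1 - i M.+1) + (if (16 <= M)%N then 8 * (i 16%N - i M) else 0).
  rewrite /series/=; elim: M => [|M ih].
    by rewrite big_nil /i invr1 subrr mulr0 addr0.
  rewrite big_nat_recr//= ih /g; have [M16|M16] := leqP 16 M.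
    by rewrite leqW//; ring.
  have [M16'|M16'] := leqP 16 M.+1.
    have -> : M.+1 = 16%N by lia.
    by rewrite subrr mulr0; ring.
  by ring.
have i16 : i 16%N = 16^-1 by [].
have := i_gt0 M; case: ifP => M16; last lra.
by have := i_gt0 M.-1; rewrite prednK; [lra|lia].
Qed.

End vertical_gap.

(** * Simultaneous recurrence of cosines *)

Section recurrence.
Variable R : realType.

(* Pigeonhole on a grid of mesh [1 / Q] in the torus. *)
Lemma cos_recurrence N (lambda : 'I_N -> R) (eps : R) : 0 < eps ->
  exists2 h : nat, (0 < h)%N & forall i, 1 - cos (h%:R * lambda i) <= eps.
Proof.
move=> eps0; pose Q := (Num.bound eps^-1).+1.
have Q0 : 0 < Q%:R :> R by rewrite ltr0n.
have Qe : Q%:R^-1 <= eps.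
  rewrite -[leRHS]invrK lef_pV2 ?posrE ?invr_gt0//.
  apply: ltW; apply: lt_le_trans (archi_boundP _) _; first by rewrite invr_ge0 ltW.
  by rewrite ler_nat.
(* Positions on the circle are recorded by cosine and sine rather than by angle. As [c + 1] ranges
   over [[0, 2]], there are [2 * Q + 1] cells, the last being reached only at [c = 1]. *)
pose cell (c : R) : 'I_(2 * Q).+1 := inord (Num.truncn (Q%:R * (c + 1))).
have cellP (c d : R) : -1 <= c <= 1 -> -1 <= d <= 1 -> cell c = cell d ->
    `|c - d| <= Q%:R^-1.
  move=> c1 d1 /(congr1 (@nat_of_ord _)).
  have tr (a : R) : -1 <= a <= 1 -> (Num.truncn (Q%:R * (a + 1)) < (2 * Q).+1)%N /\
      (Num.truncn (Q%:R * (a + 1)))%:R <= Q%:R * (a + 1) < (Num.truncn (Q%:R * (a + 1))).+1%:R.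
    move=> /andP[a1 a2]; have a0 : 0 <= Q%:R * (a + 1) by rewrite mulr_ge0 ?(ltW Q0)//; lra.
    have /andP[h1 h2] := truncn_itv a0; split; last by rewrite h1.
    rewrite ltnS -(ler_nat R); apply: le_trans h1 _.
    by rewrite natrM mulrC ler_wpM2r ?(ltW Q0)//; lra.
  have [tc /andP[c3 c4]] := tr c c1; have [td /andP[d3 d4]] := tr d d1.
  rewrite !inordK// => e; rewrite e in c3 c4.
  rewrite -[leRHS]mul1r ler_pdivlMr// -[X in _ * X](gtr0_norm Q0) -normrM ler_norml.
  have key (A B q : R) : q <= A -> A < q + 1 -> q <= B -> B < q + 1 -> -1 <= A - B <= 1.
    by move=> h1 h2 h3 h4; apply/andP; split; lra.
  have -> : (c - d) * Q%:R = Q%:R * (c + 1) - Q%:R * (d + 1) by move: Q%:R => q; ring.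
  by rewrite -addn1 natrD in c4 d4; exact: key c3 c4 d3 d4.
pose f (k : 'I_#|{ffun 'I_N -> 'I_(2 * Q).+1 * 'I_(2 * Q).+1}|.+1) :=
  [ffun i => (cell (cos (k%:R * lambda i)), cell (sin (k%:R * lambda i)))].
have /injectivePn[k [l kl fkl]] : ~~ injectiveb f.
  by apply/injectiveP => /leq_card; rewrite card_ord ltnn.
wlog lk : k l kl fkl / (l < k)%N.
  move=> W; have [lk|lk|e] := ltngtP l k; first exact: (W k l).
    by apply: (W l k) => //; rewrite eq_sym.
  by move: kl; rewrite (val_inj e) eqxx.
exists (k - l)%N; first by rewrite subn_gt0.
move=> i; have := congr1 (fun g : {ffun _} => g i) fkl; rewrite !ffunE => -[ec es].
rewrite natrB ?(ltnW lk)// mulrBl cosB.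
set a := k%:R * _ in ec es *; set b := l%:R * _ in ec es *.
have cb (y : R) : -1 <= cos y <= 1 by rewrite cos_geN1 cos_le1.
have sb (y : R) : -1 <= sin y <= 1 by rewrite sin_geN1 sin_le1.
have hc := cellP _ _ (cb a) (cb b) ec; have hs := cellP _ _ (sb a) (sb b) es.
apply: le_trans Qe.
have q0 : 0 < Q%:R^-1 :> R by rewrite invr_gt0.
have q1 : Q%:R^-1 <= 1 :> R by rewrite invf_le1// ler1n.
(* The identity behind the conclusion is [2 * (1 - cos (a - b)) = (cos a - cos b) ^ 2 + (sin a - sin
   b) ^ 2], each square being at most [1 / Q]. *)
have sq (u : R) : `|u| <= Q%:R^-1 -> u ^+ 2 <= Q%:R^-1.
  move=> hu; have hu1 := le_trans hu q1; rewrite -real_normK ?num_real// expr2.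
  by apply: le_trans hu; rewrite ler_piMl.
have := sq _ hc; have := sq _ hs.
have := cos2Dsin2 a; have := cos2Dsin2 b.
move: (Q%:R^-1) (cos a) (cos b) (sin a) (sin b) => q ca cb' sa sb'.
by lra.
Qed.

(** Scaling the frequencies by [K' > K] turns a positive integer time [h] into the time [h * K'],
    which exceeds [K]. *)
Lemma cos_recurrence_large N (lambda : 'I_N -> R) (eps K : R) : 0 < eps ->
  exists2 tau : R, K < tau & forall i, 1 - cos (tau * lambda i) <= eps.
Proof.
move=> eps0; pose K' := `|K| + 1.
have [h h0 hP] := cos_recurrence (fun i => K' * lambda i) eps0.
exists (h%:R * K') => [|i]; last by rewrite -mulrA.
have K'0 : 0 <= K' by rewrite /K' addr_ge0.
have h1 : 1 <= h%:R :> R by rewrite ler1n.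
have := ler_wpM2r K'0 h1; have := ler_norm K.
by rewrite /K'; lra.
Qed.

End recurrence.

(** * Undefinability *)

Section undefinable.
Variables (R : realType).
Implicit Types (x tau K : R).

(** What o-minimality gives at [+oo]: a finite union of intervals contains a neighbourhood of [+oo]
    or misses one. *)
Definition eventually_constant (S : set R) :=
  exists K, (forall tau, K < tau -> S tau) \/ (forall tau, K < tau -> ~ S tau).

Lemma eventually_constantU (S S' : set R) :
  eventually_constant S -> eventually_constant S' -> eventually_constant (S `|` S').
Proof.
move=> [K h] [K' h']; exists (Num.max K K').
have gt tau : Num.max K K' < tau -> K < tau /\ K' < tau.
  by rewrite gt_max => /andP.
case: h => [h|h]; first by left => tau /gt[h1 _]; left; exact: h.
case: h' => [h'|h']; first by left => tau /gt[_ h2]; right; exact: h'.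
by right => tau /gt[h1 h2] [/(h _ h1)|/(h' _ h2)].
Qed.

Lemma interval_eventually_constant (I : interval R) : eventually_constant [set` I].
Proof.
case: I => -[bl l|[]] [br u|[]].
- by exists u; right => tau ut; rewrite /= in_itv/= => /andP[_]; case: br => /=; lra.
- by exists 0; right => tau _; rewrite /= in_itv/= andbF.
- by exists l; left => tau lt; rewrite /= in_itv/= andbT; case: bl => /=; lra.
- by exists u; right => tau ut; rewrite /= in_itv/=; case: br => /=; lra.
- by exists 0; right => tau _; rewrite /= in_itv.
- by exists 0; left => tau _; rewrite /= in_itv.
- by exists 0; right => tau _; rewrite /= in_itv.
- by exists 0; right => tau _; rewrite /= in_itv.
- by exists 0; right => tau _; rewrite /= in_itv.
Qed.

Lemma intervals_eventually_constant (s : seq (interval R)) :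
  eventually_constant [set x | exists2 I, I \in s & x \in I].
Proof.
elim: s => [|I s ih]; first by exists 0; right => tau _ [].
have -> : [set x | exists2 J, J \in I :: s & x \in J] =
    [set` I] `|` [set x | exists2 J, J \in s & x \in J].
  apply/seteqP; split => x /=.
    by move=> [J]; rewrite inE => /predU1P[->|Js xJ]; [left|right; exists J].
  by case=> [xI|[J Js xJ]]; [exists I; rewrite ?mem_head|exists J; rewrite // inE Js orbT].
exact: eventually_constantU (interval_eventually_constant I) ih.
Qed.

Variables (N : structure R).
Hypothesis hN : expansion_of (R_an_star_exp R) N.
Hypothesis oN : o_minimal N.

Lemma Def_eventually_constant (P : R -> Prop) : Def N (fun e => P (e 0%N)) ->
  eventually_constant [set tau | P tau].
Proof.
move=> dP; have dA : definable N [set x : 'rV[R]_1 | P (x 0 0)].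
  by apply: definable_Def dP _ => x; rewrite (env_of_ord x 0).
have [s sP] := oN (A := [set tau | P tau]) dA.
by rewrite sP; exact: intervals_eventually_constant.
Qed.

(** Reads a definable graph at arbitrary terms, so that several graphs can be joined under
    quantifiers. *)
Lemma Def_graph (S : set R[i]) (g : R[i] -> R) (a b c : (nat -> R) -> R) :
  definable_fun N [set v : 'rV[R]_2 | S (v 0 0 +i* v 0 1)] (fun v => g (v 0 0 +i* v 0 1)) ->
  DTerm N a -> DTerm N b -> DTerm N c ->
  Def N (fun e => S (a e +i* b e) /\ c e = g (a e +i* b e)).
Proof.
move=> dg da db dc; pose h (j : 'I_(2 + 1)) := nth c [:: a; b; c] j.
have dh j : DTerm N (h j) by case: j => -[|[|[|//]]] ?; rewrite /h.
apply: Def_ext (Def_definable dg dh) => e.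
have -> : \row_j h j e = row_mx (\row_(j < 2) nth 0 [:: a e; b e] j) (const_mx (c e)).
  apply/rowP => j; rewrite !mxE; case: splitP => k jk; rewrite !mxE /h jk.
    by case: k {jk} => -[|[|//]].
  by rewrite (ord1 k).
split => /= [[v Sv]|[Sv cg]].
  move=> /eq_row_mx[vE /matrixP/(_ 0 0)]; rewrite !mxE => <-.
  by move: Sv; rewrite vE !mxE.
exists (\row_j nth 0 [:: a e; b e] j); first by rewrite !mxE.
by rewrite !mxE /= -cg.
Qed.

Variable zeta : R[i] -> R[i].
Hypothesis hzeta : is_riemann_zeta zeta.
Variable Omega : set R[i].
Hypothesis Omega2 : Omega `<=` [set w : R[i] | 2 < complex.Re w].
Hypothesis dOmega : definable_complex N Omega zeta.

(* The signs [sg = 1] and [sg = -1] account for [Im w] near [+oo] and [-oo]. *)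
Definition low_at (sg tau : R) := exists x, Omega (x +i* (sg * tau)) /\
  complex.Re (zeta (x +i* (sg * tau))) < complex.Re (zeta x%:C) - expR (- (x * ln 2)).

Definition inhabited_at (sg tau : R) := exists x, Omega (x +i* (sg * tau)).

Let graph_Omega sg : Def N (fun e => Omega (e 1%N +i* (sg * e 0%N)) /\
  e 2%N = complex.Re (zeta (e 1%N +i* (sg * e 0%N)))).
Proof.
apply: (@Def_graph Omega (fun z => complex.Re (zeta z)) (fun e => e 1%N)
  (fun e => sg * e 0%N) (fun e => e 2%N) (proj1 dOmega)); try exact: DTerm_var.
by apply: (DTerm_mul hN); [exact: DTerm_cst|exact: DTerm_var].
Qed.

(** Part 1 with [t = 2] and [s = 1]: this half-strip contains the real parts of all points of
    [Omega], so [zeta x] is available for comparison. *)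
Let graph_real := @Def_graph _ (fun z => complex.Re (zeta z)) (fun e => e 1%N)
  (fun=> 0) (fun e => e 3%N) (proj1 (zeta_definable hN hzeta 2 ltr01))
  (DTerm_var N 1) (DTerm_cst N 0) (DTerm_var N 3).

(** In the formula, variable 0 is [tau], variable 1 is [x], and variables 2 and 3 name the real
    parts of zeta at the point of [Omega] and at [x]. *)
Lemma low_at_eventually_constant sg : eventually_constant [set tau | low_at sg tau].
Proof.
apply: Def_eventually_constant.
have lt : Def N (fun e => e 2%N < e 3%N - expR (- (e 1%N * ln 2))).
  apply: (Def_lt hN); first exact: DTerm_var.
  apply: (DTerm_sub hN); first exact: DTerm_var.
  apply/(DTerm_exp hN)/(DTerm_opp hN)/(DTerm_mul hN); first exact: DTerm_var.
  exact: DTerm_cst.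
apply: Def_ext (Def_ex 1 (Def_ex 2 (Def_ex 3 (Def_and (Def_and (graph_Omega sg) graph_real) lt)))).
move=> e; split => /= [[x [u [v [[[Ox ->] [_ ->]] uv]]]]|[x [Ox uv]]].
  by exists x.
exists x, (complex.Re (zeta (x +i* (sg * e 0%N)))), (complex.Re (zeta x%:C)).
have /= x2 := Omega2 Ox; split => //; split => //; split => //.
split; first by rewrite normr0.
by move=> -[x1]; move: x2; rewrite x1; lra.
Qed.

Lemma inhabited_at_eventually_constant sg : eventually_constant [set tau | inhabited_at sg tau].
Proof.
apply: Def_eventually_constant.
apply: Def_ext (Def_ex 1 (Def_ex 2 (graph_Omega sg))).
move=> e; split => /= [[x [u [Ox _]]]|[x Ox]]; first by exists x.
by exists x, (complex.Re (zeta (x +i* (sg * e 0%N)))).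
Qed.

Lemma low_at_unbounded sg K : sg = 1 \/ sg = -1 ->
  (exists2 tau, K < tau & cos (tau * ln 2) < 0) /\
  (exists2 tau, K < tau & ~ low_at sg tau).
Proof.
move=> sg1; have cs (y : R) : cos (sg * y) = cos y.
  by case: sg1 => ->; rewrite ?mul1r// mulN1r cosN.
have ln2 : 0 < ln 2 :> R by rewrite ln_gt0//; lra.
have e16 : 0 < 1 / 16 :> R by lra.
split.
  (* At the recurrence time [cos (tau * ln 2)] is at least [15 / 16]; a shift by the half-period
     [pi / ln 2] reverses its sign. *)
  have [tau Kt tP] := cos_recurrence_large (fun n : 'I_1 => ln 2 : R) K e16.
  move: tP => /(_ ord0) tP; have pi0 := pi_gt0 R.
  have pl : 0 < pi / ln 2 :> R by rewrite divr_gt0.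
  exists (tau + pi / ln 2); first lra.
  rewrite mulrDl divfK ?gt_eqF// cosDpi.
  by lra.
have [tau Kt tP] := cos_recurrence_large (fun n : 'I_16 => ln n.+1%:R : R) K e16.
exists tau => // -[x [/Omega2/= x2]]; apply/negP; rewrite -leNgt.
apply: zeta_gap_le => //; first by rewrite ltW.
by move=> n n16; rewrite -mulrA cs; exact: (tP (Ordinal n16)).
Qed.

(** If [Omega] had points at arbitrarily large heights, it would have points at all large heights.
    The times with [cos (tau * ln 2) < 0] would then really be low, which together with the
    recurrence times contradicts eventual constancy. *)
Lemma inhabited_at_bounded sg : sg = 1 \/ sg = -1 ->
  exists K, forall tau, K < tau -> ~ inhabited_at sg tau.
Proof.
move=> sg1; have [K [inh|ninh]] := inhabited_at_eventually_constant sg; last by exists K.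
exfalso; have [K' lowK] := low_at_eventually_constant sg.
have [[tau Kt ct] [tau' Kt' nlow]] := low_at_unbounded (Num.max K K') sg1.
move: Kt Kt'; rewrite !gt_max => /andP[h1 h2] /andP[_ h3].
case: lowK => lowK; first by apply: nlow; exact: lowK.
apply: (lowK tau h2); have [x Ox] := inh tau h1; exists x; split => //.
apply: zeta_gap_gt => //; first by have /= := Omega2 Ox; lra.
by case: sg1 => ->; rewrite ?mul1r// mulN1r mulNr cosN.
Qed.

Lemma bounded_Im_of_definable : bounded_set [set complex.Im w | w in Omega].
Proof.
have [K1 h1] := inhabited_at_bounded (or_introl erefl).
have [K2 h2] := inhabited_at_bounded (or_intror erefl).
exists (Num.max K1 K2); split; first exact: num_real.
move=> M; rewrite gt_max => /andP[M1 M2] _ /= [[x y] Ow <-] /=.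
rewrite leNgt; apply/negP => My; have [y0|y0] := leP 0 y.
  apply: (h1 y); first by move: My; rewrite ger0_norm//; exact: lt_trans.
  by exists x; rewrite mul1r.
apply: (h2 (- y)); first by move: My; rewrite ltr0_norm//; exact: lt_trans.
by exists x; rewrite mulrNN mul1r.
Qed.

End undefinable.

Theorem theorem0p5 (R : realType) (zeta : R[i] -> R[i])
    (hzeta : is_riemann_zeta zeta) :
  (forall t s : R, 0 < s ->
     definable_complex (R_an_star_exp R)
       ([set z : R[i] | t < complex.Re z /\ `|complex.Im z| < s] `\ 1) zeta) /\
  (forall Omega : set R[i],
     Omega `<=` [set w : R[i] | 2 < complex.Re w] ->
     ~ bounded_set [set complex.Im w | w in Omega] ->
     forall N : structure R,
       expansion_of (R_an_star_exp R) N -> o_minimal N ->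
       ~ definable_complex N Omega zeta).
Proof.
split => [t s s0|Omega Omega2 unb N hN oN dOmega].
  by apply: zeta_definable => //; split => n; exact: subset_refl.
exact/unb/(bounded_Im_of_definable hN oN hzeta Omega2 dOmega).
Qed.
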